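(* Let $n \in \mathbb{N}$, $n \geq 2$, and let $\mathcal{P}_{n}$ be the partition monoid of degree $n$. Then the maximal subsemigroups of $\mathcal{P}_{n}$ are precisely: (a) $(\mathcal{P}_{n} \setminus \mathcal{S}_{n}) \cup U$, where $U$ is a maximal subgroup of $\mathcal{S}_{n}$ (type (M5)); (b) $\mathcal{P}_{n} \setminus \{\alpha \in \mathcal{P}_{n} : \operatorname{rank}(\alpha) = n - 1\ \text{and}\ \ker(\alpha)\ \text{is trivial}\}$ (type (M4)); (c) $\mathcal{P}_{n} \setminus \{\alpha \in \mathcal{P}_{n} : \operatorname{rank}(\alpha) = n - 1\ \text{and}\ \operatorname{dom}(\alpha) = \{1,\ldots,n\}\}$ (type (M4)); (d) $\mathcal{P}_{n} \setminus \{\alpha \in \mathcal{P}_{n} : \operatorname{rank}(\alpha) = n - 1\ \text{and}\ \operatorname{coker}(\alpha)\ \text{is trivial}\}$ (type (M3)); and (e) $\mathcal{P}_{n} \setminus \{\alpha \in \mathcal{P}_{n} : \operatorname{rank}(\alpha) = n - 1\ \text{and}\ \operatorname{codom}(\alpha) = \{1,\ldots,n\}\}$ (type (M3)). In particular, for $n \geq 2$, there are $s_{n} + 4$ maximal subsemigroups of $\mathcal{P}_{n}$, where $s_{n}$ denotes the number of maximal subgroups of the symmetric group of degree $n$. The partition monoid of degree $1$ is a semilattice of order $2$: its maximal subsemigroups are each of its singleton subsets.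
   Context: $\mathbb{N}=\{1,2,3,\ldots\}$. A maximal subsemigroup of a semigroup $S$ (maximal subgroup of a group) is a proper subsemigroup (subgroup) not contained in any other proper one. A semilattice is a commutative semigroup of idempotents. A partition of degree $n$ is an equivalence relation on $\{1,\ldots,n\}\cup\{1',\ldots,n'\}$; its classes are called blocks; a block is transverse if it contains both unprimed and primed points. The rank of a partition is its number of transverse blocks. The product $\alpha\beta$: replace each $i'$ by $i''$ in $\alpha$ to get $\alpha'$, replace each $i$ by $i''$ in $\beta$ to get $\beta'$; let $(\alpha\beta)'$ be the smallest equivalence on $\{1,\ldots,n\}\cup\{1',\ldots,n'\}\cup\{1'',\ldots,n''\}$ containing $\alpha'\cup\beta'$; then $\alpha\beta$ is the restriction of $(\alpha\beta)'$ to $\{1,\ldots,n\}\cup\{1',\ldots,n'\}$. $\mathcal{P}_n$ is the monoid of all partitions of degree $n$ with this product. $\alpha^*$ is obtained from $\alpha$ by interchanging $i$ and $i'$ for all $i$. $\ker(\alpha)$ is the restriction of the equivalence $\alpha$ to $\{1,\ldots,n\}$ (trivial means equality); $\operatorname{dom}(\alpha)$ is the set of points of $\{1,\ldots,n\}$ lying in transverse blocks; $\operatorname{coker}(\alpha)=\ker(\alpha^* )$, $\operatorname{codom}(\alpha)=\operatorname{dom}(\alpha^* )$. $\mathcal{S}_n$ denotes the group of units of $\mathcal{P}_n$: the partitions all of whose blocks have the form $\{i,j'\}$, a copy of the symmetric group of degree $n$. Types: a maximal subsemigroup $M$ of a finite monoid $S$ arises from the $\mathscr{J}$-class $J$ if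 $S\setminus M\subseteq J$; when $J$ is regular, $M$ has type (M3) if $M\cap J$ is a non-empty union of $\mathscr{L}$-classes of $J$; (M4) if it is a non-empty union of $\mathscr{R}$-classes of $J$; (M5) if it meets every $\mathscr{H}$-class of $J$. *)

(* Defs.v *)
From HB Require Import structures.
From mathcomp Require Import all_boot all_fingroup all_solvable.

Set Implicit Arguments.
Unset Strict Implicit.
Unset Printing Implicit Defensive.

Local Open Scope group_scope.

Section FiniteMonoids.

(* The library's structure of finite monoids; its involution [_^-1] is not used
   below, and need not be an inverse. *)
Variable M : finStarMonoidType.
Implicit Types (A G J U : {set M}) (a b : M).

(* As a subset closed under multiplication, the empty set is a subsemigroup;
   it is a maximal one only if M has a single element. *)
Definition subsemigroup A := [forall a in A, forall b in A, a * b \in A].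

Definition maximal_subsemigroup A :=
  maxset [pred B : {set M} | subsemigroup B && (B \proper [set: M])] A.

(* Subgroups whose identity is that of M, i.e. subgroups of the group of
   units. *)
Definition subgroup U :=
  [&& 1 \in U, subsemigroup U
    & [forall a in U, exists b in U, (a * b == 1) && (b * a == 1)]].

Definition maximal_subgroup G U :=
  maxset [pred V : {set M} | subgroup V && (V \proper G)] U.

Definition left_ideal a := [set x * a | x : M].
Definition right_ideal a := [set a * x | x : M].
Definition principal_ideal a := [set x * a * y | x : M, y : M].

Definition Lclass a := [set b | left_ideal b == left_ideal a].
Definition Rclass a := [set b | right_ideal b == right_ideal a].
Definition Hclass a := Lclass a :&: Rclass a.
Definition Jclass a := [set b | principal_ideal b == principal_ideal a].

Definition regular J := [forall a in J, exists b, a * b * a == a].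

Definition arises_from A J := (J \in [set Jclass a | a : M]) && (~: A \subset J).

Definition nonempty_union_of (K : {set {set M}}) A :=
  [exists Q : {set {set M}}, [&& Q \subset K, Q != set0 & cover Q == A]].

Definition type_M3 A :=
  [exists J : {set M}, [&& arises_from A J, regular J
    & nonempty_union_of [set Lclass a | a in J] (A :&: J)]].

Definition type_M4 A :=
  [exists J : {set M}, [&& arises_from A J, regular J
    & nonempty_union_of [set Rclass a | a in J] (A :&: J)]].

Definition type_M5 A :=
  [exists J : {set M}, [&& arises_from A J, regular J
    & [forall a in J, A :&: Hclass a != set0]]].

End FiniteMonoids.

Section Equivalences.

Variable T : finType.
Implicit Types (E F D : {set T * T}) (x y z : T).

Definition is_equiv E :=
  [&& [forall x, (x, x) \in E],
      [forall x, forall y, ((x, y) \in E) ==> ((y, x) \in E)]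
    & [forall x, forall y, forall z,
        ((x, y) \in E) && ((y, z) \in E) ==> ((x, z) \in E)]].

Lemma is_equivP E :
  reflect [/\ forall x, (x, x) \in E,
              forall x y, (x, y) \in E -> (y, x) \in E
            & forall x y z, (x, y) \in E -> (y, z) \in E -> (x, z) \in E]
          (is_equiv E).
Proof.
apply: (iffP and3P) => [[/forallP r s t]|[r s t]]; split=> //.
- by move=> x y; move/forallP/(_ x)/forallP/(_ y)/implyP: s.
- move=> x y z xy yz; move/forallP/(_ x)/forallP/(_ y)/forallP/(_ z): t.
  by rewrite xy yz.
- exact/forallP.
- by apply/forallP=> x; apply/forallP=> y; apply/implyP; apply: s.
- apply/forallP=> x; apply/forallP=> y; apply/forallP=> z.
  by apply/implyP=> /andP[]; apply: t.
Qed.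

Definition equiv_closure E := \bigcap_(F | is_equiv F && (E \subset F)) F.

Lemma equiv_closure_min E F :
  is_equiv F -> E \subset F -> equiv_closure E \subset F.
Proof. by move=> eF sEF; apply: bigcap_inf; rewrite eF. Qed.

Lemma sub_equiv_closure E : E \subset equiv_closure E.
Proof. by apply/bigcapsP=> F /andP[]. Qed.

Lemma equiv_closure_equiv E : is_equiv (equiv_closure E).
Proof.
apply/is_equivP; split=> [x|x y /bigcapP xy|x y z /bigcapP xy /bigcapP yz];
  apply/bigcapP=> F /[dup] hF /andP[/is_equivP[r s t] _]; first exact: r.
  by apply: s; apply: xy.
by apply: t (xy F hF) (yz F hF).
Qed.

Lemma equiv_closureS E F : E \subset F -> equiv_closure E \subset equiv_closure F.
Proof.
move=> sEF; apply: equiv_closure_min; first exact: equiv_closure_equiv.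
exact: subset_trans sEF (sub_equiv_closure F).
Qed.

Lemma equiv_closure_supp E (B : pred T) :
  (forall x y, (x, y) \in E -> B x && B y) ->
  forall x y, (x, y) \in equiv_closure E -> x = y \/ B x && B y.
Proof.
move=> sEB x y; pose F := [set p : T * T | (p.1 == p.2) || B p.1 && B p.2].
have eF : is_equiv F.
  apply/is_equivP; split=> [u|u v|u v w]; rewrite !inE /= ?eqxx //.
    by rewrite eq_sym andbC.
  case: eqP => [->|_] //= /andP[Bu Bv] /orP[/eqP <-|]; first by rewrite Bu Bv orbT.
  by rewrite Bu => /andP[_ ->]; rewrite orbT.
have sEF : E \subset F.
  by apply/subsetP=> -[u v] /sEB; rewrite inE /= => ->; rewrite orbT.
move/(subsetP (equiv_closure_min eF sEF)); rewrite inE /=.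
by case/orP=> [/eqP|]; [left | right].
Qed.

Lemma equiv_closure_merge E1 D E2 (A : pred T) :
    D \subset equiv_closure E1 ->
    (forall u v, A u -> A v -> (u, v) \in equiv_closure E1 ->
                 (u, v) \in equiv_closure D) ->
    (forall u v, (u, v) \in E2 -> A u && A v) ->
  forall u v, A u -> A v ->
  ((u, v) \in equiv_closure (D :|: E2)) = ((u, v) \in equiv_closure (E1 :|: E2)).
Proof.
move=> sD1 s1D sE2 u v Au Av; apply/idP/idP.
  apply/subsetP/equiv_closure_min; first exact: equiv_closure_equiv.
  rewrite subUset (subset_trans sD1) ?equiv_closureS ?subsetUl //=.
  exact: subset_trans (subsetUr _ _) (sub_equiv_closure _).
set C := equiv_closure E1; set G := equiv_closure (D :|: E2).
have /is_equivP[rC sC tC] : is_equiv C := equiv_closure_equiv E1.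
have /is_equivP[rG sG tG] : is_equiv G := equiv_closure_equiv (D :|: E2).
have CG a b : A a -> A b -> (a, b) \in C -> (a, b) \in G.
  move=> Aa Ab /s1D-/(_ Aa Ab); apply/subsetP.
  by rewrite equiv_closureS ?subsetUl.
pose F := [set p : T * T | (p \in C) || [exists a, exists b,
  [&& A a, A b, (p.1, a) \in C, (a, b) \in G & (b, p.2) \in C]]].
have FP x y : reflect ((x, y) \in C \/ exists a b,
    [/\ A a, A b, (x, a) \in C, (a, b) \in G & (b, y) \in C]) ((x, y) \in F).
  rewrite inE; apply: (iffP orP) => -[]; try by left.
    by case/existsP=> a /existsP[b /and5P[*]]; right; exists a, b.
  case=> a [b [*]]; right; apply/existsP; exists a; apply/existsP; exists b.
  exact/and5P.
have eF : is_equiv F.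
  apply/is_equivP; split.
  - by move=> x; apply/FP; left.
  - move=> x y /FP[xy|[a [b [Aa Ab xa ab b_y]]]]; apply/FP; first by left; apply: sC.
    by right; exists b, a; split=> //; [apply: sC | apply: sG | apply: sC].
  - move=> x y z /FP[xy|[a [b [Aa Ab xa ab b_y]]]] /FP[yz|[c [d [Ac Ad yc cd dz]]]];
      apply/FP; first by left; apply: tC yz.
    + by right; exists c, d; split=> //; apply: tC yc.
    + by right; exists a, b; split=> //; apply: tC yz.
    + right; exists a, d; split=> //; apply: (tG _ c) => //.
      by apply: (tG _ _ _ ab); apply: CG => //; apply: tC yc.
have sF : E1 :|: E2 \subset F.
  apply/subsetP=> -[x y] /setUP[xy|xy]; apply/FP.
    by left; apply: (subsetP (sub_equiv_closure E1)).
  have /andP[Ax Ay] := sE2 _ _ xy; right; exists x, y; split=> //.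
  by apply: (subsetP (sub_equiv_closure _)); rewrite inE xy orbT.
move/(subsetP (equiv_closure_min eF sF))/FP => [|[a [b [Aa Ab ua ab bv]]]].
  exact: CG.
by apply: (tG _ b); [apply: (tG _ _ _ _ ab) |]; apply: CG.
Qed.

End Equivalences.

Definition relabel (T T' : finType) (f : T -> T') (E : {set T * T}) : {set T' * T'} :=
  [set (f p.1, f p.2) | p in E].

Lemma preim_equiv (T T' : finType) (f : T -> T') (F : {set T' * T'}) :
  is_equiv F -> is_equiv [set p : T * T | (f p.1, f p.2) \in F].
Proof.
case/is_equivP=> r s t; apply/is_equivP; split=> [x|x y|x y z]; rewrite !inE //=.
- exact: s.
- exact: t.
Qed.

Section Relabel.

Variables (T T' : finType) (f : T -> T').

Lemma mem_relabel (E : {set T * T}) x y :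
  (x, y) \in E -> (f x, f y) \in relabel f E.
Proof. by move=> xy; apply/imsetP; exists (x, y). Qed.

Lemma relabelP (E : {set T * T}) u v :
  (u, v) \in relabel f E -> exists x y, [/\ (x, y) \in E, u = f x & v = f y].
Proof. by case/imsetP=> -[x y] /= xy [-> ->]; exists x, y. Qed.

Lemma relabel_subP (E : {set T * T}) (F : {set T' * T'}) :
  (forall x y, (x, y) \in E -> (f x, f y) \in F) -> relabel f E \subset F.
Proof.
by move=> h; apply/subsetP=> -[u v] /relabelP[x [y [xy -> ->]]]; apply: h.
Qed.

Lemma equiv_closure_relabel (E : {set T * T}) x y : injective f ->
  ((f x, f y) \in equiv_closure (relabel f E)) = ((x, y) \in equiv_closure E).
Proof.
move=> inj_f; set C := equiv_closure E; set C' := equiv_closure _.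
have /is_equivP[rC sC tC] : is_equiv C := equiv_closure_equiv E.
apply/idP/idP; last first.
  have eP := preim_equiv f (equiv_closure_equiv (relabel f E)).
  have sE : E \subset [set p : T * T | (f p.1, f p.2) \in C'].
    apply/subsetP=> -[u v] uv; rewrite inE /=.
    exact: (subsetP (sub_equiv_closure _)) (mem_relabel uv).
  by move/(subsetP (equiv_closure_min eP sE)); rewrite inE.
pose F := [set p : T' * T' | (p.1 == p.2) || (p \in relabel f C)].
have eF : is_equiv F.
  apply/is_equivP; split=> [u|u v|u v w]; rewrite !inE /= ?eqxx //.
    rewrite eq_sym => /orP[->//|/relabelP[a [b [ab -> ->]]]].
    by rewrite mem_relabel ?orbT //; apply: sC.
  case: eqP => [->|_] //= /relabelP[a [b [ab -> ->]]].
  case: eqP => [<- _|_]; first by rewrite mem_relabel ?orbT.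
  case/relabelP=> [c [d [cd /inj_f bc ->]]]; rewrite -{}bc in cd.
  by rewrite mem_relabel ?orbT //; apply: tC cd.
have sF : relabel f E \subset F.
  apply: relabel_subP => u v uv; rewrite inE /= mem_relabel ?orbT //.
  exact: (subsetP (sub_equiv_closure _)).
move/(subsetP (equiv_closure_min eF sF)); rewrite inE /=.
case/orP=> [/eqP/inj_f->//|/relabelP[a [b [ab /inj_f-> /inj_f->]]]].
exact: ab.
Qed.

End Relabel.

Lemma relabel_comp (T1 T2 T3 : finType) (f : T2 -> T3) (g : T1 -> T2) E :
  relabel f (relabel g E) = relabel (f \o g) E.
Proof. by rewrite /relabel -imset_comp. Qed.

(* The unprimed point i is [inl i], the primed point i' is [inr i]. *)
Definition point (n : nat) : finType := ('I_n + 'I_n)%type.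

Record ptn (n : nat) := Ptn {
  ptn_rel : {set point n * point n};
  ptn_equiv : is_equiv ptn_rel }.

HB.instance Definition _ n := [isSub for @ptn_rel n].
HB.instance Definition _ n := [Finite of ptn n by <:].

Section PartitionMonoid.

Variable n : nat.
Implicit Types (a b c : ptn n) (x y : point n).

(* In [point3], i, i' and i'' are [inl (inl i)], [inl (inr i)] and [inr i]. *)
Definition point3 : finType := (point n + 'I_n)%type.

Definition prime_to_double x : point3 :=
  match x with inl i => inl (inl i) | inr i => inr i end.

Definition unprimed_to_double x : point3 :=
  match x with inl i => inr i | inr i => inl (inr i) end.

Definition product_graph a b : {set point3 * point3} :=
  relabel prime_to_double (ptn_rel a) :|: relabel unprimed_to_double (ptn_rel b).

Definition ptn_mul_rel a b : {set point n * point n} :=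
  [set p | (inl p.1 : point3, inl p.2 : point3)
             \in equiv_closure (product_graph a b)].

Lemma ptn_mul_equiv a b : is_equiv (ptn_mul_rel a b).
Proof.
exact: (@preim_equiv (point n) point3 inl _
  (equiv_closure_equiv (product_graph a b))).
Qed.

Definition ptn_mul a b : ptn n := Ptn (ptn_mul_equiv a b).

Definition unprime x : 'I_n := match x with inl i => i | inr i => i end.

Lemma ptn_one_equiv : is_equiv [set p : point n * point n | unprime p.1 == unprime p.2].
Proof.
by apply/is_equivP; split=> [x|x y|x y z]; rewrite !inE //= => /eqP-> // /eqP->.
Qed.

Definition ptn_one : ptn n := Ptn ptn_one_equiv.

Definition prime_swap x : point n :=
  match x with inl i => inr i | inr i => inl i end.

Definition ptn_star a : ptn n := Ptn (preim_equiv prime_swap (ptn_equiv a)).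

Lemma ptnP a b : (forall x y, ((x, y) \in ptn_rel a) = ((x, y) \in ptn_rel b)) ->
  a = b.
Proof. by move=> eq_ab; apply/val_inj/setP=> -[x y]; apply: eq_ab. Qed.

Section Levels.

Variables (T : finType) (l0 l1 l2 : 'I_n -> T).

Definition level2 (l l' : 'I_n -> T) x : T :=
  match x with inl i => l i | inr i => l' i end.

Definition level3 (u : point3) : T :=
  match u with inl x => level2 l0 l2 x | inr i => l1 i end.

Lemma ptn_mul_levels a b x y : injective level3 ->
  ((x, y) \in ptn_rel (ptn_mul a b)) =
  ((level2 l0 l2 x, level2 l0 l2 y) \in
     equiv_closure (relabel (level2 l0 l1) (ptn_rel a)
                    :|: relabel (level2 l1 l2) (ptn_rel b))).
Proof.
move=> inj3; rewrite inE /= -(equiv_closure_relabel _ _ _ inj3).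
rewrite /product_graph /relabel imsetU -!/(relabel _ _) !relabel_comp.
by congr (_ \in equiv_closure (_ :|: _)); apply: eq_imset => -[[i|i] [j|j]].
Qed.

End Levels.

Definition point4 : finType := ('I_4 * 'I_n)%type.
Definition lev (k : nat) (i : 'I_n) : point4 := (inord k, i).

Lemma lev_inj k l i j : k < 4 -> l < 4 -> lev k i = lev l j -> k = l /\ i = j.
Proof.
move=> lk ll [/(congr1 val) /=]; rewrite !inordK // => -> ->.
Qed.

Lemma level3_inj k l m : k < 4 -> l < 4 -> m < 4 -> uniq [:: k; l; m] ->
  injective (level3 (lev k) (lev l) (lev m)).
Proof.
move=> hk hl hm /=; rewrite !inE negb_or => /and3P[/andP[/eqP kl /eqP km] /eqP lm _].
by move=> [[i|i]|i] [[j|j]|j] /= /lev_inj[] // e ->; congruence.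
Qed.

Lemma level2_supp (P : pred point4) (l l' : 'I_n -> point4) a u v :
  (forall i, P (l i)) -> (forall i, P (l' i)) ->
  (u, v) \in relabel (level2 l l') (ptn_rel a) -> P u && P v.
Proof.
by move=> Pl Pl' /relabelP[[i|i] [[j|j] [_ -> ->]]] /=; rewrite ?Pl ?Pl'.
Qed.

Lemma point4P (u : point4) : exists2 k, k < 4 & exists i, u = lev k i.
Proof. by case: u => k i; exists k => //; exists i; rewrite /lev inord_val. Qed.

Lemma level_merge k l m o a b (E2 : {set point4 * point4}) :
    perm_eq [:: k; l; m; o] (iota 0 4) ->
    (forall u v, (u, v) \in E2 -> (u.1 != inord l) && (v.1 != inord l)) ->
  forall u v : point4, u.1 != inord l -> v.1 != inord l ->
  ((u, v) \in equiv_closure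
      (relabel (level2 (lev k) (lev m)) (ptn_rel (ptn_mul a b)) :|: E2)) =
  ((u, v) \in equiv_closure
      ((relabel (level2 (lev k) (lev l)) (ptn_rel a)
        :|: relabel (level2 (lev l) (lev m)) (ptn_rel b)) :|: E2)).
Proof.
move=> kP sE2 u v; pose A := [pred w : point4 | w.1 != inord l].
have mem_lt j : j \in [:: k; l; m; o] -> j < 4.
  by rewrite (perm_mem kP) mem_iota.
have [hk hl hm ho] : [/\ k < 4, l < 4, m < 4 & o < 4].
  by split; apply: mem_lt; rewrite !inE eqxx ?orbT.
have uP : uniq [:: k; l; m; o] by rewrite (perm_uniq kP) iota_uniq.
have uP3 : uniq [:: k; l; m].
  by move: uP => /=; rewrite !inE !negb_or => /and4P[/and3P[-> -> _] /andP[-> _] _ _].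
have lev_neq i j w : i < 4 -> j < 4 -> i != j -> (lev i w).1 != inord j.
  by move=> hi hj; apply: contra => /eqP/(congr1 val) /=; rewrite !inordK // => ->.
have inj3 := level3_inj hk hl hm uP3.
apply: (@equiv_closure_merge _ _ _ _ A) => //.
  apply: relabel_subP => x y.
  by rewrite (ptn_mul_levels _ _ _ _ inj3).
move=> {}u {}v Au Av uv.
set E1 := (X in equiv_closure X) in uv.
pose B := [pred w : point4 | w.1 != inord o].
have sE1B p q : (p, q) \in E1 -> B p && B q.
  by case/setUP; apply: level2_supp => i; apply: lev_neq => //;
     move: uP; rewrite /= !inE !negb_or -!andbA => /and5P[? ? ? ?] /and3P[].
have [->|/andP[Bu Bv]] := equiv_closure_supp sE1B uv.
  by have /is_equivP[] := equiv_closure_equiv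
      (relabel (level2 (lev k) (lev m)) (ptn_rel (ptn_mul a b))).
have lvl w : A w -> B w -> exists x, w = level2 (lev k) (lev m) x.
  have [j hj [i ->]] := point4P w; rewrite /= => nl no.
  have: j \in [:: k; l; m; o] by rewrite (perm_mem kP) mem_iota.
  rewrite !inE => /or4P[]/eqP ej; rewrite ej ?eqxx // in nl no *.
  - by exists (inl i).
  - by exists (inr i).
have [x ex] := lvl u Au Bu; have [y ey] := lvl v Av Bv.
rewrite ex ey; apply: (subsetP (sub_equiv_closure _)); apply: mem_relabel.
by rewrite (ptn_mul_levels _ _ _ _ inj3) -ex -ey.
Qed.

Lemma ptn_mulA : associative ptn_mul.
Proof.
move=> a b c; apply: ptnP => x y.
have nl i j w : i < 4 -> j < 4 -> i != j -> (lev i w).1 != inord j.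
  by move=> hi hj; apply: contra => /eqP/(congr1 val) /=; rewrite !inordK // => ->.
have n03 j z : j < 4 -> 0 != j -> 3 != j -> (level2 (lev 0) (lev 3) z).1 != inord j.
  by move=> hj j0 j3; case: z => i; apply: nl.
rewrite (@ptn_mul_levels _ (lev 0) (lev 1%N) (lev 3)); last exact: level3_inj.
rewrite (@ptn_mul_levels _ (lev 0) (lev 2) (lev 3)); last exact: level3_inj.
rewrite setUC (@level_merge 1%N 2 3 0) ?n03 //; last first.
  by move=> u v; apply: (level2_supp (P := fun w => w.1 != inord 2)) => i; apply: nl.
rewrite (@level_merge 0 1%N 2 3) ?n03 //; last first.
  by move=> u v; apply: (level2_supp (P := fun w => w.1 != inord 1%N)) => i; apply: nl.
by rewrite setUC setUA.
Qed.

Lemma ptn_mul1x : left_id ptn_one ptn_mul.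
Proof.
move=> a; apply: ptnP => x y; rewrite [LHS]inE /=.
set E := product_graph _ _.
have /is_equivP[rC sC tC] := equiv_closure_equiv E.
have subC := subsetP (sub_equiv_closure E).
apply/idP/idP; last first.
  have up z : (inl z : point3, unprimed_to_double z) \in equiv_closure E.
    case: z => i //=; apply/subC/setUP; left.
    by apply: (mem_relabel prime_to_double (x := inl i) (y := inr i)); rewrite inE.
  move=> xy; apply: (tC _ _ _ (up x)); apply: (tC _ _ _ _ (sC _ _ (up y))).
  by apply/subC/setUP; right; apply: mem_relabel.
pose r (u : point3) : point n := match u with inl z => z | inr i => inl i end.
have eF := preim_equiv r (ptn_equiv a).
have sF : E \subset [set p : point3 * point3 | (r p.1, r p.2) \in ptn_rel a].
  rewrite subUset; apply/andP; split; apply: relabel_subP => u v; rewrite !inE /=.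
    have /is_equivP[ra _ _] := ptn_equiv a.
    by case: u v => [i|i] [j|j] /= /eqP->.
  by case: u v => [i|i] [j|j].
by move/(subsetP (equiv_closure_min eF sF)); rewrite inE.
Qed.

Lemma prime_swapK : involutive prime_swap.
Proof. by case. Qed.

Lemma ptn_starK : involutive ptn_star.
Proof. by move=> a; apply: ptnP => x y; rewrite !inE /= !prime_swapK. Qed.

Lemma ptn_star_rel a : ptn_rel (ptn_star a) = relabel prime_swap (ptn_rel a).
Proof.
apply/setP=> -[x y]; apply/idP/idP; rewrite inE /=.
  by move/(mem_relabel prime_swap); rewrite !prime_swapK.
by case/relabelP=> u [v [uv -> ->]]; rewrite !prime_swapK.
Qed.

Lemma ptn_starM : {morph ptn_star : a b / ptn_mul a b >-> ptn_mul b a}.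
Proof.
move=> a b; apply: ptnP => x y; rewrite !inE /=.
pose flip (u : point3) : point3 :=
  match u with inl z => inl (prime_swap z) | inr i => inr i end.
have flipK : involutive flip by move=> [[i|i]|i].
rewrite -(equiv_closure_relabel _ _ _ (inv_inj flipK)) /= !prime_swapK.
rewrite /product_graph !ptn_star_rel !relabel_comp setUC.
rewrite {1}/relabel imsetU -!/(relabel _ _) !relabel_comp.
by congr (_ \in equiv_closure (_ :|: _)); apply: eq_imset => -[[i|i] [j|j]].
Qed.

End PartitionMonoid.

HB.instance Definition _ n := isStarMonoid.Build (ptn n)
  (@ptn_mulA n) (@ptn_mul1x n) (@ptn_starK n) (@ptn_starM n).

Section PartitionParameters.

Variable n : nat.
Implicit Types (a : ptn n) (B : {set point n}).

Definition ptn_blocks a : {set {set point n}} :=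
  equivalence_partition (fun x y => (x, y) \in ptn_rel a) [set: point n].

Definition transverse B :=
  [exists i : 'I_n, inl i \in B] && [exists i : 'I_n, inr i \in B].

Definition ptn_rank a : nat := #|[set B in ptn_blocks a | transverse B]|.

Definition ptn_ker a : rel 'I_n := fun i j => (inl i, inl j) \in ptn_rel a.

Definition ptn_dom a : {set 'I_n} :=
  [set i | [exists B in ptn_blocks a, transverse B && (inl i \in B)]].

Definition ptn_coker a := ptn_ker (ptn_star a).
Definition ptn_codom a := ptn_dom (ptn_star a).

Definition trivial_rel (r : rel 'I_n) := [forall i, forall j, r i j == (i == j)].

End PartitionParameters.

Definition sym_units n : {set ptn n} :=
  [set a | [forall B in ptn_blocks a, exists i, exists j, B == [set inl i; inr j]]].

(* Main.v *)
Require Import Defs.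
From mathcomp Require Import all_boot all_fingroup all_solvable.

(** Write [a^-1] for the involution of the partition monoid, which exchanges
    primed and unprimed points. The argument rests on the identity
    [a * a^-1 * a = a] ([mul_starK]) and on the fact that [a * a^-1] is determined
    by the kernel and the domain of [a] ([mul_star_eqP]), and determines them.

    There are only two ways for the unprimed side of [a] to be compatible with
    rank [n - 1]: either every point is alone in its kernel class and exactly one
    point [i] lies outside the domain, in which case [a * a^-1] is the projection
    [puncture i]; or the domain is full and exactly two points [i], [j] are
    identified, in which case [a * a^-1] is [merge i j]. The primed side is
    treated in the same way with [a^-1 * a]. This gives the four sets removed in
    the theorem: [upper_punctured], [upper_merged], [lower_punctured] and
    [lower_merged].

    The units, all [puncture i] and all [merge i j] generate the monoid
    ([ptn_generation]): if [i] and [j] are identified by [a], then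
    [a = merge i j * (puncture i * a)] and [puncture i * a] is a smaller relation;
    when no such reduction is possible on either side, [a] is a partial
    bijection, obtained from a unit by puncturing.

    Let a subsemigroup [N] contain all units. If [N] meets [upper_punctured] and
    [lower_punctured] in a common element [a], then [a * a^-1] and [a^-1 * a] are
    conjugate under a unit [u], and a power of [a * u] equals [a * a^-1]; so every
    [puncture i] is in [N]. In the same way, a common element of [upper_merged]
    and [lower_merged] puts every [merge i j] in [N]. If [a] is in both
    [upper_punctured] and [lower_merged], and [c] in both [upper_merged] and
    [lower_punctured], then for some unit [u] the product [a * u * c] has the
    upper pattern of [a] and the lower pattern of [c], and likewise with [a] and
    [c] exchanged, which gives elements of the two previous kinds. If [N] meets
    all four sets, it has elements of the first two kinds or of the last two, so
    it is everything ([containing_units_cases]). Since the complement of each set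
    is a subsemigroup ([critical_sets_prime]) and none of the sets contains
    another, these complements are the maximal subsemigroups containing the units.

    A maximal subsemigroup that misses some unit contains the ideal of non-units,
    and meets the group of units in a maximal subgroup. *)

Set Implicit Arguments.
Unset Strict Implicit.
Unset Printing Implicit Defensive.

Local Open Scope group_scope.

(** * Finite monoids with an involution *)

Section StarMonoid.

Variable M : finStarMonoidType.
Implicit Types (A B J : {set M}) (a b e x y : M).

Lemma subsemigroupP A :
  reflect {in A &, forall a b, a * b \in A} (subsemigroup A).
Proof.
apply: (iffP forall_inP) => [h a b aA bA|h a aA]; first exact: (forall_inP (h a aA)).
by apply/forall_inP=> b; apply: h.
Qed.

Lemma subsemigroupM A a b :
  subsemigroup A -> a \in A -> b \in A -> a * b \in A.
Proof. by move/subsemigroupP; apply. Qed.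

Lemma subsemigroupX A a k : subsemigroup A -> a \in A -> a ^+ k.+1 \in A.
Proof.
move=> sgA aA; elim: k => // k IHk; rewrite expgS; exact: subsemigroupM.
Qed.

Lemma maximal_subsemigroupP A :
  reflect [/\ subsemigroup A, A != setT
            & forall B, subsemigroup B -> B != setT -> A \subset B -> B = A]
          (maximal_subsemigroup A).
Proof.
have properT B : (B \proper [set: M]) = (B != setT) by rewrite properT.
apply: (iffP maxsetP) => /= [[/andP[sgA nA] maxA]|[sgA nA maxA]].
  split=> // [|B sgB nB]; first by rewrite -properT.
  by apply: maxA; rewrite sgB properT.
by split=> [|B /andP[sgB nB]]; [rewrite sgA properT | apply: maxA; rewrite -?properT].
Qed.

(** Such an [a] belongs to a finite group with identity [e], hence has a power
    equal to [e]. *)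
Lemma expg_star a e :
  a * a^-1 = e -> a^-1 * a = e -> a * e = a -> exists k, a ^+ k.+1 = e.
Proof.
move=> aV Va ae; pose f (k : 'I_#|M|.+1) := a ^+ k.+1.
(* Two powers of [a] coincide; multiply by a power of [a^-1]. *)
have /injectivePn[k0 [l0 ne_kl fkl]] : ~~ injectiveb f.
  by apply/negP=> /injectiveP/leq_card; rewrite card_ord ltnn.
have eXX k : a ^+ k * e = a ^+ k \/ k = 0%N.
  by case: k => [|k]; [right | left; rewrite expgSr -mulgA ae].
have XV k : a ^+ k.+1 * a^-1 ^+ k.+1 = e.
  elim: k => // k IHk; rewrite expgSr (expgS a^-1) mulgA -(mulgA _ a) aV.
  by have [->|//] := eXX k.+1.
have [k [l [lt_kl akl]]]: exists k l, k < l /\ a ^+ k.+1 = a ^+ l.+1.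
  have [lt|lt|eq_kl] := ltngtP k0 l0; first by exists k0, l0.
    by exists l0, k0.
  by case/eqP: ne_kl; apply: val_inj.
exists (l - k).-1; rewrite prednK ?subn_gt0 //.
have [<-|] := eXX (l - k); last by move/eqP; rewrite subn_eq0 leqNgt lt_kl.
by rewrite -{1}(XV k) mulgA -expgD addnS subnK ?(ltnW lt_kl) // -akl XV.
Qed.

Lemma principal_idealP a b :
  reflect (exists x y, b = x * a * y) (b \in principal_ideal a).
Proof.
apply: (iffP imset2P) => [[x y _ _ ->]|[x [y ->]]]; first by exists x, y.
by exists x y.
Qed.

Lemma principal_ideal_sub a b :
  b \in principal_ideal a -> principal_ideal b \subset principal_ideal a.
Proof.
move=> /principal_idealP[x [y ->]]; apply/subsetP=> _ /principal_idealP[u [v ->]].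
by apply/principal_idealP; exists (u * x), (y * v); rewrite !mulgA.
Qed.

Lemma mem_Jclass a b :
  (b \in Jclass a) = (b \in principal_ideal a) && (a \in principal_ideal b).
Proof.
have self (c : M) : c \in principal_ideal c.
  by apply/principal_idealP; exists 1, 1; rewrite mul1g mulg1.
rewrite inE; apply/eqP/andP=> [eq_ab|[ba ab]].
  by split; [rewrite -eq_ab | rewrite eq_ab]; apply: self.
by apply/eqP; rewrite eqEsubset !principal_ideal_sub.
Qed.

Lemma Jclass_trans a b c : b \in Jclass a -> c \in Jclass b -> c \in Jclass a.
Proof. by rewrite !inE => /eqP <-. Qed.

Lemma RclassP a b :
  reflect ((exists x, b = a * x) /\ (exists x, a = b * x)) (b \in Rclass a).
Proof.
have self (c : M) : c \in right_ideal c by apply/imsetP; exists 1; rewrite ?mulg1.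
rewrite inE; apply: (iffP eqP) => [eq_ab|[[x ->] [y def_a]]].
  split.
    by have := self b; rewrite eq_ab => /imsetP[x _ ->]; exists x.
  by have := self a; rewrite -eq_ab => /imsetP[x _ ->]; exists x.
apply/eqP; rewrite eqEsubset; apply/andP; split; apply/subsetP=> _ /imsetP[z _ ->].
  by apply/imsetP; exists (x * z); rewrite ?mulgA.
by apply/imsetP; exists (y * z); rewrite // !mulgA -def_a.
Qed.

Lemma LclassP a b :
  reflect ((exists x, b = x * a) /\ (exists x, a = x * b)) (b \in Lclass a).
Proof.
have self (c : M) : c \in left_ideal c by apply/imsetP; exists 1; rewrite ?mul1g.
rewrite inE; apply: (iffP eqP) => [eq_ab|[[x ->] [y def_a]]].
  split.
    by have := self b; rewrite eq_ab => /imsetP[x _ ->]; exists x.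
  by have := self a; rewrite -eq_ab => /imsetP[x _ ->]; exists x.
apply/eqP; rewrite eqEsubset; apply/andP; split; apply/subsetP=> _ /imsetP[z _ ->].
  by apply/imsetP; exists (z * x); rewrite ?mulgA.
by apply/imsetP; exists (z * y); rewrite // -!mulgA -def_a.
Qed.

Lemma Rclass_sub_Jclass a : Rclass a \subset Jclass a.
Proof.
apply/subsetP=> b /RclassP[[x def_b] [y def_a]]; rewrite mem_Jclass.
apply/andP; split; apply/principal_idealP.
  by exists 1, x; rewrite mul1g.
by exists 1, y; rewrite mul1g.
Qed.

Lemma Lclass_sub_Jclass a : Lclass a \subset Jclass a.
Proof.
apply/subsetP=> b /LclassP[[x def_b] [y def_a]]; rewrite mem_Jclass.
apply/andP; split; apply/principal_idealP.
  by exists x, 1; rewrite mulg1.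
by exists y, 1; rewrite mulg1.
Qed.

(** A nonempty part of [J] that is stable under passing to the class of an
    element is a union of classes; [K] is meant to be [Lclass] or [Rclass]. *)
Lemma nonempty_union_of_classes (K : M -> {set M}) A J :
    (forall a, a \in K a) -> (forall a, a \in A :&: J -> K a \subset A :&: J) ->
  A :&: J != set0 -> nonempty_union_of [set K a | a in J] (A :&: J).
Proof.
move=> K_id K_sub nzA; apply/existsP; exists (K @: (A :&: J)).
rewrite imsetS ?subsetIr // imset_eq0 nzA cover_imset /=.
rewrite eqEsubset; apply/andP; split; first exact/bigcupsP.
by apply/subsetP=> a aAJ; apply/bigcupP; exists a.
Qed.

End StarMonoid.

(** * Blocks, kernels and products of partitions *)

Section Partitions.

Variable n : nat.
Implicit Types (a b c e : ptn n) (i j k l : 'I_n) (x y z : point n).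

Lemma ptn_refl a x : (x, x) \in ptn_rel a.
Proof. by have /is_equivP[] := ptn_equiv a. Qed.

Lemma ptn_sym a x y : (x, y) \in ptn_rel a -> (y, x) \in ptn_rel a.
Proof. by have /is_equivP[_ + _] := ptn_equiv a; apply. Qed.

Lemma ptn_trans a y x z :
  (x, y) \in ptn_rel a -> (y, z) \in ptn_rel a -> (x, z) \in ptn_rel a.
Proof. by have /is_equivP[_ _ +] := ptn_equiv a; apply. Qed.

Lemma star_rel a x y :
  ((x, y) \in ptn_rel a^-1) = ((prime_swap x, prime_swap y) \in ptn_rel a).
Proof. by rewrite inE. Qed.

Lemma one_rel x y : ((x, y) \in ptn_rel (1 : ptn n)) = (unprime x == unprime y).
Proof. by rewrite inE. Qed.

Lemma block_in a x : [set y | (x, y) \in ptn_rel a] \in ptn_blocks a.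
Proof.
by apply/imsetP; exists x; rewrite ?inE //; apply/setP=> y; rewrite !inE.
Qed.

Lemma blockP a (X : {set point n}) :
  reflect (exists x, X = [set y | (x, y) \in ptn_rel a]) (X \in ptn_blocks a).
Proof.
apply: (iffP idP) => [/imsetP[x _ ->]|[x ->]]; last exact: block_in.
by exists x; apply/setP=> y; rewrite !inE.
Qed.

Lemma ptn_domP i a :
  reflect (exists j, (inl i, inr j) \in ptn_rel a) (i \in ptn_dom a).
Proof.
rewrite inE; apply: (iffP exists_inP) => [[X /blockP[x ->]]|[j ij]].
  case/andP=> /andP[_ /existsP[j]]; rewrite !inE => xj xi.
  by exists j; apply: ptn_trans (ptn_sym xi) xj.
exists [set y | (inl i, y) \in ptn_rel a]; rewrite ?block_in // inE ptn_refl andbT.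
apply/andP; split; apply/existsP; first by exists i; rewrite inE ptn_refl.
by exists j; rewrite inE.
Qed.

Lemma ptn_dom_ker i j a : ptn_ker a i j -> (i \in ptn_dom a) = (j \in ptn_dom a).
Proof.
move=> ij; apply/ptn_domP/ptn_domP=> -[k ik]; exists k; last exact: ptn_trans ik.
exact: ptn_trans (ptn_sym ij) ik.
Qed.

(** The unprimed points of the domain of [e], together with all primed points. *)
Definition live e x := if x is inl i then i \in ptn_dom e else true.

(** The map [g] acting on unprimed points only. *)
Definition transfer (g : 'I_n -> 'I_n) x : point n :=
  if x is inl i then inl (g i) else x.

(** The product [e * a] when the cokernel of [e] is contained in the kernel of
    [a]: on the middle level [e] connects no two points that [a] does not connect.
    So a point of the domain is carried to the middle level by any choice [g] of a
    primed partner and connected there by [a], and the other unprimed points keep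
    the blocks they have in [e]. *)
Lemma mul_rel e a g :
    (forall i, i \in ptn_dom e -> (inl i, inr (g i)) \in ptn_rel e) ->
    (forall i j, (inr i, inr j) \in ptn_rel e -> (inl i, inl j) \in ptn_rel a) ->
  forall x y, ((x, y) \in ptn_rel (e * a)) =
    if live e x && live e y then (transfer g x, transfer g y) \in ptn_rel a
    else [&& ~~ live e x, ~~ live e y & (x, y) \in ptn_rel e].
Proof.
move=> eg sea x y; rewrite inE /=; set E := product_graph _ _.
have /is_equivP[rC sC tC] := equiv_closure_equiv E.
have subC := subsetP (sub_equiv_closure E).
apply/idP/idP; last first.
  have up z : live e z ->
      (inl z : point3 n, unprimed_to_double (transfer g z)) \in equiv_closure E.
    case: z => i //= /eg eig; apply/subC/setUP; left.
    exact: (mem_relabel (@prime_to_double n) eig).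
  case: ifP => [/andP[xl yl] xy|_ /and3P[]].
    apply: (tC _ _ _ (up _ xl)); apply: (tC _ _ _ _ (sC _ _ (up _ yl))).
    by apply/subC/setUP; right; apply: mem_relabel.
  case: x y => [i|//] [j|//] _ _ xy; apply/subC/setUP; left.
  exact: (mem_relabel (@prime_to_double n) xy).
(* [F] contains the product graph: it retracts the points that reach the middle
   level onto [a], and leaves the others with the relation of [e]. *)
pose L (u : point3 n) := if u is inl z then live e z else true.
pose G (u : point3 n) : point n := match u with
  inl z => if live e z then transfer g z else z | inr k => inl k end.
pose F := [set p : point3 n * point3 n | (L p.1 == L p.2) &&
   ((G p.1, G p.2) \in ptn_rel (if L p.1 then a else e))].
have eF : is_equiv F.
  apply/is_equivP; split=> [u|u v|u v w]; rewrite !inE /= ?eqxx ?ptn_refl //.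
    by case/andP=> /eqP-> /ptn_sym ->; rewrite eqxx.
  by move=> /andP[/eqP-> uv] /andP[-> vw]; apply: ptn_trans vw.
have sF : E \subset F.
  rewrite subUset; apply/andP; split; apply: relabel_subP => u v; last first.
    by case: u v => [i|i] [j|j] uv; rewrite inE.
  have lr i k : (inl i, inr k) \in ptn_rel e ->
     i \in ptn_dom e /\ (inl (g i), inl k) \in ptn_rel a.
    move=> ik; have ie : i \in ptn_dom e by apply/ptn_domP; exists k.
    by split=> //; apply/sea/(ptn_trans (ptn_sym (eg _ ie))).
  rewrite inE; case: u v => [i|i] [j|j] uv /=.
  - rewrite (ptn_dom_ker uv) eqxx /=; case: ifP => // je.
    have ie : i \in ptn_dom e by rewrite (ptn_dom_ker uv).
    apply: sea; apply: ptn_trans (ptn_sym (eg _ ie)) _.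
    exact: ptn_trans uv (eg _ je).
  - by have [-> ->] := lr _ _ uv.
  - by have [-> /ptn_sym->] := lr _ _ (ptn_sym uv).
  - exact: sea.
move/(subsetP (equiv_closure_min eF sF)); rewrite inE /=.
by case: (live e x); case: (live e y).
Qed.

(** Some [j] such that [j'] is in the block of [i]; [i] itself by default. *)
Definition dom_image e i := odflt i [pick j | (inl i, inr j) \in ptn_rel e].

Lemma dom_imageP e i : i \in ptn_dom e -> (inl i, inr (dom_image e i)) \in ptn_rel e.
Proof.
by case/ptn_domP=> j ij; rewrite /dom_image; case: pickP => [//|/(_ j)]; rewrite ij.
Qed.

Definition same_side x y :=
  match x, y with inl _, inl _ | inr _, inr _ => true | _, _ => false end.

Lemma mul_star_rel a x y : ((x, y) \in ptn_rel (a * a^-1)) =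
  ptn_ker a (unprime x) (unprime y)
    && (same_side x y || (unprime x \in ptn_dom a)).
Proof.
rewrite (@mul_rel a a^-1 (dom_image a)); last 2 first.
- exact: dom_imageP.
- by move=> i j; rewrite star_rel.
have dI i : i \in ptn_dom a -> (inr (dom_image a i), inl i) \in ptn_rel a.
  by move/dom_imageP/ptn_sym.
have lift i z : i \in ptn_dom a ->
    ((inr (dom_image a i), z) \in ptn_rel a) = ((inl i, z) \in ptn_rel a).
  move=> /dI ia; apply/idP/idP; first exact: ptn_trans (ptn_sym ia).
  exact: ptn_trans ia.
have symE u v : ((u, v) \in ptn_rel a) = ((v, u) \in ptn_rel a).
  by apply/idP/idP; apply: ptn_sym.
case: x y => [i|i] [j|j] /=; rewrite ?star_rel /ptn_ker /= ?andbT ?andbF ?orbF //.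
- have [ij|] := boolP ((inl i, inl j) \in ptn_rel a); last first.
    move=> nij; case: ifP => [/andP[ia ja]|_]; last by rewrite ?andbF.
    by rewrite lift // symE lift // symE (negbTE nij).
  rewrite (ptn_dom_ker ij) andbb andbT; case: ifP => [ja|->//].
  by rewrite lift ?(ptn_dom_ker ij) // symE lift // symE.
- by case: ifP => ia; rewrite ?lift ?ia // ?andbF ?andbT.
- case: ifP => [ja|nja]; first rewrite symE lift // symE.
    by have [/ptn_dom_ker->|] := boolP ((inl i, inl j) \in ptn_rel a); rewrite ?ja.
  by have [/ptn_dom_ker->|//] := boolP ((inl i, inl j) \in ptn_rel a); rewrite nja.
Qed.

Lemma dom_mul_star a : ptn_dom (a * a^-1) = ptn_dom a.
Proof.
apply/setP=> i; apply/ptn_domP/idP=> [[j]|ia].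
  by rewrite mul_star_rel => /andP[].
by exists i; rewrite mul_star_rel /= ia andbT; apply: ptn_refl.
Qed.

(** The partition monoid is a regular star-semigroup. *)
Lemma mul_starK a : a * a^-1 * a = a.
Proof.
apply: ptnP => x y.
rewrite (@mul_rel _ _ id); last 2 first.
- move=> i; rewrite dom_mul_star mul_star_rel /= => ->; rewrite andbT.
  exact: ptn_refl.
- by move=> i j; rewrite mul_star_rel => /andP[].
have tE z : transfer id z = z by case: z.
rewrite !tE; case: ifP => // /negbT.
rewrite negb_and; case: x y => [i|i] [j|j] //=; rewrite ?dom_mul_star ?orbF.
- rewrite mul_star_rel /= andbT /ptn_ker.
  have [/ptn_dom_ker<-|] := boolP ((_, _) \in ptn_rel a); last by rewrite ?andbF.
  by rewrite orbb => ->.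
- rewrite andbF => /negP ni; apply/esym/negP=> ij; apply: ni.
  by apply/ptn_domP; exists j.
- move=> /negP ni; apply/esym/negP=> ij; apply: ni.
  by apply/ptn_domP; exists i; apply: ptn_sym.
Qed.

(** * Rank *)

(** The kernel class of [i], in the domain or not. *)
Definition upper_class a i : {set 'I_n} := [set j | ptn_ker a i j].

Lemma upper_class_eq a i j : (upper_class a i == upper_class a j) = ptn_ker a i j.
Proof.
apply/eqP/idP=> [/setP/(_ j)|ij]; first by rewrite !inE => ->; apply: ptn_refl.
apply/setP=> k; rewrite !inE; apply/idP/idP; first exact: ptn_trans (ptn_sym ij).
exact: ptn_trans ij.
Qed.

Lemma ptn_rankE a : ptn_rank a = #|upper_class a @: ptn_dom a|.
Proof.
pose up (X : {set point n}) := [set i | inl i \in X].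
have upE i : up [set y | (inl i, y) \in ptn_rel a] = upper_class a i.
  by apply/setP=> j; rewrite !inE.
rewrite /ptn_rank -(@card_in_imset _ _ up).
  congr #|pred_of_set _|; apply/setP=> Y; apply/imsetP/imsetP.
    case=> X; rewrite inE => /andP[/blockP[x ->] /andP[/existsP[i xi] /existsP[j xj]]] ->.
    rewrite !inE in xi xj; exists i.
      by apply/ptn_domP; exists j; apply: ptn_trans (ptn_sym xi) xj.
    apply/setP=> k; rewrite !inE; apply/idP/idP; first exact: ptn_trans (ptn_sym xi).
    exact: ptn_trans xi.
  case=> i /ptn_domP[j ij] ->; exists [set y | (inl i, y) \in ptn_rel a].
    rewrite inE block_in /=; apply/andP; split; apply/existsP.
      by exists i; rewrite inE ptn_refl.
    by exists j; rewrite inE.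
  by rewrite upE.
move=> X Y; rewrite !inE => /andP[/blockP[x ->] /andP[/existsP[i]]].
rewrite inE => xi _ /andP[/blockP[y ->] _] /setP/(_ i); rewrite !inE xi => /esym yi.
apply/setP=> z; rewrite !inE; apply/idP/idP=> h.
  by apply: ptn_trans yi _; apply: ptn_trans (ptn_sym xi) h.
by apply: ptn_trans xi _; apply: ptn_trans (ptn_sym yi) h.
Qed.

Lemma ptn_rank_star a : ptn_rank a^-1 = ptn_rank a.
Proof.
have le b : ptn_rank b <= ptn_rank b^-1.
  pose f (X : {set point n}) := prime_swap (n := n) @: X.
  have f_inj : injective f by apply: imset_inj; apply: inv_inj; apply: prime_swapK.
  rewrite /ptn_rank -(card_imset _ f_inj); apply/subset_leq_card/subsetP=> Y.
  case/imsetP=> X; rewrite inE => /andP[/blockP[x ->] /andP[/existsP[i xi] /existsP[j xj]]] ->.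
  have fE : f [set y | (x, y) \in ptn_rel b]
          = [set y | (prime_swap x, y) \in ptn_rel b^-1].
    apply/setP=> y; rewrite inE star_rel prime_swapK.
    apply/imsetP/idP=> [[z + ->]|xy]; first by rewrite inE prime_swapK.
    by exists (prime_swap y); rewrite ?prime_swapK ?inE.
  rewrite !inE in xi xj; rewrite inE fE block_in /=; apply/andP; split; apply/existsP.
    by exists j; rewrite inE star_rel prime_swapK.
  by exists i; rewrite inE star_rel prime_swapK.
by apply/eqP; rewrite eqn_leq le -{2}[a]invgK le.
Qed.

Lemma trivial_kerP a :
  reflect (forall i j, ptn_ker a i j -> i = j) (trivial_rel (ptn_ker a)).
Proof.
apply: (iffP forallP) => [h i j ij | h i].
  by move/forallP/(_ j)/eqP: (h i); rewrite ij => /esym/eqP.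
apply/forallP=> j; apply/eqP; apply/idP/eqP => [/h //|->]; exact: ptn_refl.
Qed.

Lemma ptn_rank_trivial_ker a : trivial_rel (ptn_ker a) -> ptn_rank a = #|ptn_dom a|.
Proof.
move/trivial_kerP=> h; rewrite ptn_rankE card_imset // => i j /eqP.
by rewrite upper_class_eq => /h.
Qed.

Lemma ptn_ker_mul a b i j : ptn_ker a i j -> ptn_ker (a * b) i j.
Proof.
move=> ij; rewrite /ptn_ker inE /=; apply: (subsetP (sub_equiv_closure _)).
apply/setUP; left; exact: (mem_relabel (@prime_to_double n) ij).
Qed.

Lemma ptn_dom_mul a b : ptn_dom (a * b) \subset ptn_dom a.
Proof.
apply/subsetP=> i /ptn_domP[j]; rewrite inE /=; apply: contraTT => ni.
(* The kernel class of [i] is a union of components of the product graph. *)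
pose P (u : point3 n) := if u is inl (inl k) then ptn_ker a i k else false.
pose F := [set p : point3 n * point3 n | P p.1 == P p.2].
have eF : is_equiv F.
  by apply/is_equivP; split=> [x|x y|x y z]; rewrite !inE //= => /eqP-> // /eqP->.
suff sF : product_graph a b \subset F.
  apply/negP=> /(subsetP (equiv_closure_min eF sF)).
  by rewrite inE /= /ptn_ker ptn_refl.
rewrite subUset; apply/andP; split; apply: relabel_subP => -[k|k] [l|l] kl; rewrite inE //=.
- apply/eqP; apply/idP/idP; rewrite /ptn_ker => h; first exact: ptn_trans kl.
  exact: ptn_trans (ptn_sym kl).
- rewrite eqbF_neg; apply: contra ni => ik; apply/ptn_domP; exists l.
  exact: ptn_trans kl.
- rewrite eq_sym eqbF_neg; apply: contra ni => ik; apply/ptn_domP; exists k.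
  exact: ptn_trans (ptn_sym kl).
Qed.

Lemma ptn_rank_mull a b : ptn_rank (a * b) <= ptn_rank a.
Proof.
rewrite !ptn_rankE; apply: leq_trans (subset_leq_card (imsetS _ (ptn_dom_mul a b))).
(* The class of [i] for [a * b] is a function of its class for [a]. *)
pose h (X : {set 'I_n}) := \bigcup_(i in X) upper_class (a * b) i.
rewrite (@eq_imset _ _ _ (h \o upper_class a)) ?imset_comp ?leq_imset_card //.
move=> i /=; apply/setP=> k; rewrite inE; apply/idP/bigcupP=> [ik|[j]].
  by exists i; rewrite inE //; apply: ptn_refl.
by rewrite !inE => /(ptn_ker_mul b); apply: ptn_trans.
Qed.

(** The projection [a * a^-1] amounts to the kernel and the domain of [a]. *)
Lemma mul_star_eqP a b :
  (ptn_ker a =2 ptn_ker b /\ ptn_dom a = ptn_dom b) <-> a * a^-1 = b * b^-1.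
Proof.
split=> [[ker_ab dom_ab]|ab].
  by apply: ptnP => x y; rewrite !mul_star_rel ker_ab dom_ab.
split; last by rewrite -dom_mul_star ab dom_mul_star.
have kerE c i j : ptn_ker c i j = ptn_ker (c * c^-1) i j.
  by rewrite [RHS]mul_star_rel /= andbT.
by move=> i j; rewrite kerE ab -kerE.
Qed.


(** * Permutations and basic projections *)

Lemma fiber_equiv (T : eqType) (f : point n -> T) :
  is_equiv [set p : point n * point n | f p.1 == f p.2].
Proof.
by apply/is_equivP; split=> [x|x y|x y z]; rewrite !inE //= => /eqP-> // /eqP->.
Qed.

(** The partition whose blocks are the nonempty fibres of [f]. *)
Definition fiber_ptn (T : eqType) (f : point n -> T) : ptn n := Ptn (fiber_equiv f).

Lemma fiber_rel (T : eqType) (f : point n -> T) x y :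
  ((x, y) \in ptn_rel (fiber_ptn f)) = (f x == f y).
Proof. by rewrite inE. Qed.

(** The unit with blocks [{i, (s i)'}]. *)
Definition perm_ptn (s : 'S_n) : ptn n :=
  fiber_ptn (fun x => match x with inl i => s i | inr j => j end).

(** The identity with the block [{i, i'}] split into two singletons. *)
Definition puncture i : ptn n :=
  fiber_ptn (fun x => if unprime x == i then x else inl (unprime x)).

(** The retraction sending [i] to [j] and fixing the other points. *)
Definition collapse i j : 'I_n -> 'I_n := fun k => if k == i then j else k.

(** The identity with the blocks of [i] and [j] joined, so [1] if [i = j]. *)
Definition merge i j : ptn n := fiber_ptn (fun x => collapse i j (unprime x)).

Lemma perm_mul_rel s a x y : ((x, y) \in ptn_rel (perm_ptn s * a)) =
  ((transfer s x, transfer s y) \in ptn_rel a).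
Proof.
have dom_s z : live (perm_ptn s) z.
  by case: z => //= i; apply/ptn_domP; exists (s i); rewrite fiber_rel.
rewrite (@mul_rel _ _ s) ?dom_s // => [i _|i j]; rewrite fiber_rel //.
by move/eqP->; apply: ptn_refl.
Qed.

Lemma perm_ptnM s t : perm_ptn (s * t) = perm_ptn s * perm_ptn t.
Proof.
apply: ptnP => x y; rewrite perm_mul_rel !fiber_rel.
by case: x y => [i|i] [j|j] /=; rewrite ?permM.
Qed.

Lemma perm_ptn1 : perm_ptn 1 = 1.
Proof.
apply: ptnP => x y; rewrite fiber_rel one_rel.
by case: x y => [i|i] [j|j] /=; rewrite ?perm1.
Qed.

Lemma perm_ptnV s : perm_ptn s^-1 = (perm_ptn s)^-1.
Proof.
apply: ptnP => x y; rewrite star_rel !fiber_rel.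
case: x y => [i|i] [j|j] //=; rewrite ?(inj_eq perm_inj) //.
  by rewrite -(inj_eq (@perm_inj _ s)) permKV.
by rewrite -(inj_eq (@perm_inj _ s)) permKV.
Qed.

Lemma perm_ptn_inj : injective perm_ptn.
Proof.
move=> s t st; apply/permP=> i; apply/esym/eqP.
have: (inl i, inr (s i)) \in ptn_rel (perm_ptn s) by rewrite fiber_rel.
by rewrite st fiber_rel.
Qed.

(** The permutation [s] acting on primed and unprimed points alike. *)
Definition relocate (s : 'S_n) x : point n :=
  match x with inl i => inl (s i) | inr i => inr (s i) end.

Lemma perm_conj_rel s a x y :
  ((x, y) \in ptn_rel (perm_ptn s * a * (perm_ptn s)^-1)) =
  ((relocate s x, relocate s y) \in ptn_rel a).
Proof.
rewrite -[_ * _]invgK star_rel invMg invgK perm_mul_rel star_rel perm_mul_rel.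
by case: x y => [i|i] [j|j].
Qed.

Lemma trivial_ker_full_dom a : trivial_rel (ptn_ker a) -> ptn_dom a = setT ->
  exists s, a = perm_ptn s.
Proof.
move=> /trivial_kerP kerI domT.
have gP i : (inl i, inr (dom_image a i)) \in ptn_rel a by apply: dom_imageP; rewrite domT inE.
have g_inj : injective (dom_image a).
  by move=> i j ij; apply/kerI/(ptn_trans (gP i)); rewrite ij ptn_sym.
have gE i z : ((inr (dom_image a i), z) \in ptn_rel a) = ((inl i, z) \in ptn_rel a).
  by apply/idP/idP; apply: ptn_trans; rewrite // ptn_sym.
have symE u v : ((u, v) \in ptn_rel a) = ((v, u) \in ptn_rel a).
  by apply/idP/idP; apply: ptn_sym.
exists (perm g_inj); apply: ptnP => x y; rewrite fiber_rel.
have ker_eq i j : ((inl i, inl j) \in ptn_rel a) = (i == j).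
  by apply/idP/eqP=> [/kerI|->]; rewrite ?ptn_refl.
have gK j : dom_image a ((perm g_inj)^-1 j) = j by rewrite -(permE g_inj) permKV.
case: x y => [i|i] [j|j]; rewrite ?permE.
- by rewrite ker_eq (inj_eq g_inj).
- by rewrite -{1}(gK j) symE gE ker_eq -(inj_eq g_inj) gK eq_sym.
- by rewrite -{1}(gK i) gE ker_eq -(inj_eq g_inj) gK.
- by rewrite -{1}(gK i) -{1}(gK j) gE symE gE ker_eq -(inj_eq g_inj) !gK eq_sym.
Qed.

Lemma sym_unitsP a :
  reflect (exists s, a = perm_ptn s) (a \in sym_units n).
Proof.
rewrite inE; apply: (iffP forall_inP) => [h|[s ->] X /blockP[x ->]]; last first.
  have [i xi]: exists i, (x, inr i) \in ptn_rel (perm_ptn s).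
    by case: x => i; [exists (s i)|exists i]; rewrite fiber_rel.
  apply/existsP; exists (s^-1 i); apply/existsP; exists i; apply/eqP/setP=> y.
  rewrite !inE; move: xi; rewrite fiber_rel => /eqP ->.
  case: y => j /=; last by rewrite (inj_eq inr_inj) eq_sym.
  rewrite (inj_eq inl_inj) orbF -{1}(permKV s i) (inj_eq perm_inj) eq_sym //.
have block x : exists i j, [set y | (x, y) \in ptn_rel a] = [set inl i; inr j].
  have /existsP[i /existsP[j /eqP ->]] := h _ (block_in a x).
  by exists i, j.
have dom_full i : i \in ptn_dom a.
  have [k [j /setP ij]] := block (inl i); apply/ptn_domP; exists j.
  by have := ij (inr j); rewrite !inE eqxx orbT.
have ker_triv i j : ptn_ker a i j -> i = j.
  have [k [l /setP eq_k]] := block (inl i); rewrite /ptn_ker => ij.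
  have := eq_k (inl i); have := eq_k (inl j).
  rewrite !inE ij ptn_refl !orbF !(inj_eq inl_inj).
  by move=> /esym/eqP-> /esym/eqP->.
by apply: trivial_ker_full_dom; [apply/trivial_kerP | apply/setP=> i; rewrite dom_full inE].
Qed.


Lemma puncture_rel i x y : ((x, y) \in ptn_rel (puncture i)) =
  (x == y) || (unprime x == unprime y) && (unprime x != i).
Proof.
rewrite fiber_rel; case: x y => [j|j] [k|k] /=;
  rewrite ?(inj_eq inl_inj) ?(inj_eq inr_inj) /=.
all: have [->|/negbTE ji] := eqVneq j i; have [->|/negbTE ki] := eqVneq k i.
all: rewrite ?(inj_eq inl_inj) ?(inj_eq inr_inj) /= ?(eq_sym i) ?ji ?ki.
all: by rewrite ?eqxx ?andbF ?andbT ?orbb.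
Qed.

Lemma ker_puncture i j k : ptn_ker (puncture i) j k = (j == k).
Proof.
rewrite /ptn_ker fiber_rel /=; case: ifP => [/eqP->|_]; case: ifP => [/eqP->|_];
  by rewrite (inj_eq inl_inj).
Qed.

Lemma dom_puncture i : ptn_dom (puncture i) = [set~ i].
Proof.
apply/setP=> j; rewrite in_setC1; apply/ptn_domP/idP=> [[k]|ji].
  by rewrite puncture_rel => /andP[].
by exists j; rewrite puncture_rel /= eqxx ji.
Qed.

Lemma ker_merge i j k l :
  ptn_ker (merge i j) k l = (collapse i j k == collapse i j l).
Proof. exact: fiber_rel. Qed.

Lemma dom_merge i j : ptn_dom (merge i j) = setT.
Proof. by apply/setP=> k; rewrite in_setT; apply/ptn_domP; exists k; rewrite fiber_rel. Qed.

Lemma puncture_star i : (puncture i)^-1 = puncture i.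
Proof.
apply: ptnP => x y; rewrite star_rel !puncture_rel (inj_eq (inv_inj (@prime_swapK n))).
by case: x y => [j|j] [k|k].
Qed.

Lemma merge_star i j : (merge i j)^-1 = merge i j.
Proof. by apply: ptnP => x y; rewrite star_rel !fiber_rel; case: x y => [k|k] [l|l]. Qed.

Lemma puncture_proj i : puncture i * (puncture i)^-1 = puncture i.
Proof.
apply: ptnP => x y; rewrite mul_star_rel ker_puncture dom_puncture in_setC1.
rewrite puncture_rel; case: x y => [j|j] [k|k] /=;
  rewrite ?andbT ?(inj_eq inl_inj) ?(inj_eq inr_inj) //;
  by case: (j == k).
Qed.

Lemma merge_proj i j : merge i j * (merge i j)^-1 = merge i j.
Proof.
by apply: ptnP => x y; rewrite mul_star_rel ker_merge dom_merge inE fiber_rel orbT andbT.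
Qed.

Lemma puncture_mul_rel i a x y : ((x, y) \in ptn_rel (puncture i * a)) =
  if (x == inl i) || (y == inl i) then x == y else (x, y) \in ptn_rel a.
Proof.
have dom_i j : (j \in ptn_dom (puncture i)) = (j != i).
  by rewrite dom_puncture in_setC1.
rewrite (@mul_rel _ _ id); last 2 first.
- by move=> j; rewrite dom_i puncture_rel /= eqxx => ->.
- move=> j k; rewrite puncture_rel (inj_eq inr_inj) /=.
  by case: (j =P k) => [->|]; rewrite ?ptn_refl.
have tE z : transfer id z = z by case: z.
have liveE z : live (puncture i) z = (z != inl i).
  by case: z => j //=; rewrite dom_i (inj_eq inl_inj).
rewrite !tE !liveE puncture_rel.
have [->|nx] := eqVneq x (inl i); have [->|ny] := eqVneq y (inl i) => //=.
by rewrite (negbTE nx).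
Qed.

Lemma collapseK i j k : i != j -> collapse i j (collapse i j k) = collapse i j k.
Proof.
by rewrite /collapse eq_sym => /negbTE ij; case: (k =P i) => [_|/eqP/negbTE->//]; rewrite ij.
Qed.

(** For [i != j], its upper pattern is that of [merge i j] and its lower pattern
    that of [puncture i]: see [contract_star_r] and [contract_star_l]. *)
Definition contract i j := merge i j * puncture i.

Lemma contract_rel i j x y : ((x, y) \in ptn_rel (contract i j)) =
  if (x == inr i) || (y == inr i) then x == y
  else collapse i j (unprime x) == collapse i j (unprime y).
Proof.
have uE z : (prime_swap z == inl i) = (z == inr i).
  by rewrite -(inj_eq (inv_inj (@prime_swapK n))) prime_swapK.
rewrite -[contract _ _]invgK star_rel invMg puncture_star merge_star puncture_mul_rel.
rewrite !uE (inj_eq (inv_inj (@prime_swapK n))) fiber_rel.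
by case: x y => [k|k] [l|l].
Qed.

Lemma contract_arrow i j k : i != j ->
  (inl k, inr (collapse i j k)) \in ptn_rel (contract i j).
Proof.
move=> ij; rewrite contract_rel /= collapseK // eqxx (inj_eq inr_inj).
by rewrite /collapse; case: (k =P i) => [_|/eqP/negbTE->//]; rewrite eq_sym (negbTE ij).
Qed.

Lemma coker_contract i j k l :
  (inr k, inr l) \in ptn_rel (contract i j) -> k = l.
Proof.
rewrite contract_rel !(inj_eq inr_inj) /= /collapse.
by have [->|_] := eqVneq k i; have [->|_] := eqVneq l i => //= /eqP.
Qed.

(** This is the reduction behind the generation of the monoid: [a] is recovered
    by merging [i] with [j] after having isolated [i]. *)
Lemma contractK a i j : i != j -> ptn_ker a i j -> contract i j * a = a.
Proof.
move=> ij a_ij; apply: ptnP => x y; rewrite (@mul_rel _ _ (collapse i j)); last 2 first.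
- by move=> k _; apply: contract_arrow.
- by move=> k l /coker_contract->; apply: ptn_refl.
have liveT z : live (contract i j) z.
  by case: z => //= k; apply/ptn_domP; exists (collapse i j k); apply: contract_arrow.
have tP z : (z, transfer (collapse i j) z) \in ptn_rel a.
  case: z => k /=; last exact: ptn_refl.
  by rewrite /collapse; case: eqP => [->//|_]; apply: ptn_refl.
rewrite !liveT /=; apply/idP/idP=> xy.
  by apply: ptn_trans (tP x) _; apply: ptn_trans xy _; apply: ptn_sym.
by apply: ptn_trans (ptn_sym (tP x)) _; apply: ptn_trans xy _.
Qed.

Lemma contract_star_r i j : i != j ->
  contract i j * (contract i j)^-1 = merge i j.
Proof.
move=> ij; rewrite -[RHS]merge_proj; apply/mul_star_eqP; split=> [k l|].
  by rewrite ker_merge /ptn_ker contract_rel /=.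
rewrite dom_merge; apply/setP=> k; rewrite in_setT; apply/ptn_domP.
by exists (collapse i j k); apply: contract_arrow.
Qed.

Lemma contract_star_l i j : i != j ->
  (contract i j)^-1 * contract i j = puncture i.
Proof.
move=> ij; rewrite -{2}[contract i j]invgK -[RHS]puncture_proj.
apply/mul_star_eqP; split=> [k l|].
  rewrite ker_puncture /ptn_ker star_rel /=.
  apply/idP/eqP=> [|->]; first exact: coker_contract.
  exact: (ptn_refl (contract i j)).
rewrite dom_puncture; apply/setP=> k; rewrite in_setC1; apply/ptn_domP/idP=> [[l]|ki].
  by rewrite star_rel contract_rel (inj_eq inr_inj) /=; case: eqP.
by exists k; rewrite star_rel contract_rel /= (inj_eq inr_inj) (negbTE ki) eqxx.
Qed.

Lemma puncture_conj (s : 'S_n) i j : s j = i ->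
  perm_ptn s * puncture i * (perm_ptn s)^-1 = puncture j.
Proof.
move=> <-; apply: ptnP => x y; rewrite perm_conj_rel !puncture_rel.
by case: x y => [k|k] [l|l] /=;
   rewrite ?(inj_eq inl_inj) ?(inj_eq inr_inj) ?(inj_eq perm_inj).
Qed.

Lemma merge_conj (s : 'S_n) i j k l : s k = i -> s l = j ->
  perm_ptn s * merge i j * (perm_ptn s)^-1 = merge k l.
Proof.
move=> <- <-; apply: ptnP => x y; rewrite perm_conj_rel !fiber_rel.
have colE m : collapse (s k) (s l) (s m) = s (collapse k l m).
  by rewrite /collapse (inj_eq perm_inj); case: ifP.
by case: x y => [p|p] [q|q] /=; rewrite !colE (inj_eq perm_inj).
Qed.

Lemma puncture_conjugate i j : exists s,
  perm_ptn s * puncture i * (perm_ptn s)^-1 = puncture j.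
Proof. by exists (tperm j i); apply: puncture_conj; rewrite tpermL. Qed.

Lemma merge_conjugate i j k l : i != j -> k != l -> exists s,
  perm_ptn s * merge i j * (perm_ptn s)^-1 = merge k l.
Proof.
move=> ij kl; exists (tperm k i * tperm (tperm k i l) j); apply: merge_conj.
  rewrite permM tpermL; apply: tpermD; last by rewrite eq_sym.
  by rewrite -[X in _ != X](tpermL k i) (inj_eq perm_inj) eq_sym.
by rewrite permM tpermL.
Qed.

(** * Kernels and domains in rank [n - 1] *)

Lemma imset_collapse (T : finType) (f : 'I_n -> T) i j : i != j -> f i = f j ->
  f @: setT = f @: [set~ i].
Proof.
move=> ij fij; apply/eqP; rewrite eqEsubset; apply/andP; split; last exact/imsetS/subsetT.
apply/subsetP=> _ /imsetP[k _ ->]; have [->|ki] := eqVneq k i.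
  by rewrite fij imset_f // in_setC1 eq_sym.
by rewrite imset_f // in_setC1.
Qed.

(** A function on [n] points with [n - 1] values identifies exactly one pair. *)
Lemma card_imset_predP (T : finType) (f : 'I_n -> T) : 0 < n ->
  (#|f @: setT| = n - 1)%N <->
  exists i j, i != j /\ forall k l, (f k == f l) = (collapse i j k == collapse i j l).
Proof.
move=> n_gt0; have cC i : #|[set~ i]| = (n - 1)%N by rewrite cardsC1 card_ord subn1.
split=> [card_f|[i [j [ij fE]]]].
  have /injectivePn[i [j ij fij]] : ~~ injectiveb f.
    apply/negP=> /injectiveP/card_imset-/(_ [set: 'I_n]) card_f'.
    move: card_f; rewrite card_f' cardsT card_ord subn1 => eq_n.
    by have := leqnn n; rewrite -{1}(prednK n_gt0) -eq_n ltnn.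
  exists i, j; split=> //.
  have f_inj : {in [set~ i] &, injective f}.
    by apply/imset_injP; rewrite -(imset_collapse ij fij) card_f cC.
  have cE k : f (collapse i j k) = f k by rewrite /collapse; case: eqP => // ->.
  have ci k : collapse i j k \in [set~ i].
    by rewrite in_setC1 /collapse; case: (k =P i) => [_|/eqP//]; rewrite eq_sym.
  by move=> k l; rewrite -(cE k) -(cE l) (inj_in_eq f_inj).
have fij : f i = f j.
  by apply/eqP; rewrite fE /collapse eqxx; case: (j == i).
rewrite (imset_collapse ij fij) card_in_imset ?cC // => k l.
rewrite !in_setC1 => /negbTE ki /negbTE li /eqP; rewrite fE /collapse ki li.
by move/eqP.
Qed.

Lemma upper_punctureP a : 0 < n ->
  reflect (exists i, a * a^-1 = puncture i)
          ((ptn_rank a == n - 1)%N && trivial_rel (ptn_ker a)).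
Proof.
move=> n_gt0; apply: (iffP andP) => [[/eqP rk_a ker_a]|[i]].
  have /eqP/cards1P[i dom_a] : #|~: ptn_dom a| = 1%N.
    by rewrite cardsCs setCK card_ord -ptn_rank_trivial_ker // rk_a subKn.
  exists i; rewrite -puncture_proj; apply/mul_star_eqP; split=> [k l|].
    rewrite ker_puncture; apply/idP/eqP=> [|->]; last exact: ptn_refl.
    exact: (trivial_kerP _ ker_a).
  by rewrite dom_puncture -dom_a setCK.
rewrite -puncture_proj => /mul_star_eqP[ker_a dom_a].
have triv_a : trivial_rel (ptn_ker a).
  by apply/trivial_kerP=> k l; rewrite ker_a ker_puncture => /eqP.
by rewrite ptn_rank_trivial_ker // dom_a dom_puncture cardsC1 card_ord subn1.
Qed.

Lemma upper_mergeP a : 0 < n ->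
  reflect (exists i j, i != j /\ a * a^-1 = merge i j)
          ((ptn_rank a == n - 1)%N && (ptn_dom a == setT)).
Proof.
move=> n_gt0; apply: (iffP andP) => [[/eqP rk_a /eqP dom_a]|[i [j [ij]]]].
  rewrite ptn_rankE dom_a in rk_a.
  have [i [j [ij clE]]] := (card_imset_predP _ n_gt0).1 rk_a; exists i, j; split=> //.
  rewrite -merge_proj; apply/mul_star_eqP; rewrite dom_merge; split=> // k l.
  by rewrite -upper_class_eq clE ker_merge.
rewrite -merge_proj => /mul_star_eqP[ker_a]; rewrite dom_merge => dom_a.
rewrite dom_a eqxx ptn_rankE dom_a; split=> //; apply/eqP/card_imset_predP=> //.
by exists i, j; split=> // k l; rewrite upper_class_eq ker_a ker_merge.
Qed.

Lemma unit_rank a : 0 < n -> ptn_rank a = n -> a \in sym_units n.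
Proof.
move=> n_gt0 rk_a; apply/sym_unitsP; rewrite ptn_rankE in rk_a.
have le_dom := leq_imset_card (upper_class a) (mem (ptn_dom a)).
have dom_a : ptn_dom a = setT.
  by apply/eqP; rewrite eqEcard subsetT cardsT card_ord /= -{1}rk_a.
rewrite dom_a in rk_a; apply: trivial_ker_full_dom => //; apply/trivial_kerP=> i j.
have /imset_injP cl_inj : #|upper_class a @: setT| == #|[set: 'I_n]|.
  by rewrite rk_a cardsT card_ord.
by rewrite -upper_class_eq => /eqP/cl_inj; apply; rewrite in_setT.
Qed.

(** * Generation *)

Lemma trivial_cokerP a :
  reflect (forall i j, (inr i, inr j) \in ptn_rel a -> i = j)
          (trivial_rel (ptn_coker a)).
Proof.
have cokerE i j : ptn_ker a^-1 i j = ((inr i, inr j) \in ptn_rel a) by exact: star_rel.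
by apply: (iffP (trivial_kerP _)) => h i j; [rewrite -cokerE | rewrite cokerE]; apply: h.
Qed.


(** A partition all of whose blocks are singletons or of the form [{k, l'}], with
    [{i}] a block, is obtained by puncturing at [i] one with one more transverse
    block. *)
Lemma puncture_factor a i :
    trivial_rel (ptn_ker a) -> trivial_rel (ptn_coker a) -> i \notin ptn_dom a ->
  exists b, [/\ puncture i * b = a, trivial_rel (ptn_ker b),
                trivial_rel (ptn_coker b) & ptn_dom b = i |: ptn_dom a].
Proof.
move=> /[dup] ker_a /trivial_kerP kerP /[dup] coker_a /trivial_cokerP cokerP dom_i.
have [j dom_j] : exists j, j \notin ptn_dom a^-1.
  apply/existsP; rewrite -negb_forall; apply: contra dom_i => /forallP codomT.
  have : ptn_dom a == setT.
    rewrite eqEcard subsetT /= cardsT -cardsT.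
    rewrite -(ptn_rank_trivial_ker ker_a) -ptn_rank_star.
    rewrite (ptn_rank_trivial_ker coker_a); apply: subset_leq_card.
    by apply/subsetP=> k _; apply: codomT.
  by move/eqP->; rewrite in_setT.
have single_i y : ((inl i, y) \in ptn_rel a) = (y == inl i).
  apply/idP/eqP=> [|->]; last exact: ptn_refl.
  case: y => k iy; first by rewrite (kerP _ _ iy).
  by case/negP: dom_i; apply/ptn_domP; exists k.
have single_j y : ((inr j, y) \in ptn_rel a) = (y == inr j).
  apply/idP/eqP=> [|->]; last exact: ptn_refl.
  case: y => k jy; last by rewrite (cokerP _ _ jy).
  by case/negP: dom_j; apply/ptn_domP; exists k; rewrite star_rel.
have symE u v : ((u, v) \in ptn_rel a) = ((v, u) \in ptn_rel a).
  by apply/idP/idP; apply: ptn_sym.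
(* There are as many unprimed as primed singletons; [b] joins [i] to the primed
   singleton [j']. *)
pose r x : point n := if x == inr j then inl i else x.
pose b : ptn n := Ptn (preim_equiv r (ptn_equiv a)).
have bE x y : ((x, y) \in ptn_rel b) = ((r x, r y) \in ptn_rel a) by rewrite inE.
have r_i y : y != inl i -> (r y == inl i) = (y == inr j).
  by rewrite /r => /negbTE yi; case: ifP => //; rewrite eqxx.
exists b; split.
- apply: ptnP => x y; rewrite puncture_mul_rel bE.
  have [->|xi] := eqVneq x (inl i); first by rewrite /= single_i eq_sym.
  have [->|yi] /= := eqVneq y (inl i); first by rewrite symE single_i.
  have [->|xj] := eqVneq x (inr j); first by rewrite single_j {1}/r eqxx single_i r_i.
  have [->|yj] := eqVneq y (inr j).
    by rewrite symE {1}/r eqxx single_i r_i // symE single_j.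
  by rewrite /r (negbTE xj) (negbTE yj).
- by apply/trivial_kerP=> k l; rewrite /ptn_ker bE; apply: kerP.
- apply/trivial_cokerP=> k l; rewrite bE /r !(inj_eq inr_inj).
  have [->|kj] := eqVneq k j; have [->|lj] := eqVneq l j => //.
  + by rewrite single_i.
  + by rewrite symE single_i.
  + exact: cokerP.
apply/setP=> k; rewrite in_setU1; apply/ptn_domP/orP=> [[l]|].
  rewrite bE /r (inj_eq inr_inj) /=; have [_|_] := eqVneq l j.
    by rewrite symE single_i (inj_eq inl_inj) => /eqP->; left.
  by move=> kl; right; apply/ptn_domP; exists l.
case=> [/eqP->|/ptn_domP[l kl]]; first by exists j; rewrite bE /r eqxx single_i.
exists l; rewrite bE /r (inj_eq inr_inj) /=; case: eqP => // lj.
by move: kl; rewrite lj symE single_j.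
Qed.

(** The units, the [puncture i] and the [merge i j] generate the monoid. *)
Lemma ptn_generation (N : {set ptn n}) a :
    subsemigroup N -> sym_units n \subset N -> (forall i, puncture i \in N) ->
    (forall i j, i != j -> merge i j \in N) ->
  a \in N.
Proof.
move=> sgN /subsetP unitN punctureN mergeN.
have smaller b i j : i != j -> ptn_ker b i j -> #|ptn_rel (puncture i * b)| < #|ptn_rel b|.
  move=> ij b_ij; apply: proper_card; apply/properP; split.
    apply/subsetP=> -[x y]; rewrite puncture_mul_rel.
    by case: ifP => // _ /eqP->; apply: ptn_refl.
  by exists (inl i, inl j) => //; rewrite puncture_mul_rel eqxx (inj_eq inl_inj).
have star_card b : #|ptn_rel b^-1| = #|ptn_rel b|.
  rewrite (ptn_star_rel b) card_imset // => -[? ?] [? ?] [].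
  by move=> /(inv_inj (@prime_swapK n)) -> /(inv_inj (@prime_swapK n)) ->.
have partial_permN b m : #|~: ptn_dom b| < m -> trivial_rel (ptn_ker b) ->
    trivial_rel (ptn_coker b) -> b \in N.
  elim: m b => // m IHm b lt_bm ker_b coker_b.
  have [domT|[i]] := set_0Vmem (~: ptn_dom b).
    apply: unitN; apply/sym_unitsP; apply: trivial_ker_full_dom => //.
    by rewrite -[ptn_dom b]setCK domT setC0.
  rewrite in_setC => dom_i.
  have [c [def_b ker_c coker_c dom_c]] := puncture_factor ker_b coker_b dom_i.
  rewrite -def_b; apply: subsemigroupM => //; apply: IHm => //; rewrite dom_c.
  rewrite ltnS in lt_bm; apply: leq_trans lt_bm; apply: proper_card; rewrite properC.
  by apply/properP; split; [exact: subsetUr | exists i; rewrite ?setU11].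
(* Induction on the number of related pairs, reducing the kernel of [a], or that
   of [a^-1], as long as it is not trivial. *)
have [m] := ubnP #|ptn_rel a|; elim: m a => // m IHm a lt_am.
have split_ker b : ~~ trivial_rel (ptn_ker b) ->
    exists i j, [/\ i != j, b = merge i j * (puncture i * b)
                  & #|ptn_rel (puncture i * b)| < #|ptn_rel b|].
  move=> /forallPn[i /forallPn[j b_ij]]; exists i, j.
  have ij : i != j.
    by apply: contraNneq b_ij => <-; rewrite /ptn_ker ptn_refl eqxx.
  have {}b_ij : ptn_ker b i j by move: b_ij; rewrite (negbTE ij) eqbF_neg negbK.
  by split=> //; [rewrite mulgA -/(contract i j) contractK | apply: smaller b_ij].
have [ker_a|/split_ker[i [j [ij def_a lt_pa]]]] :=
  boolP (trivial_rel (ptn_ker a)); last first.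
  by rewrite def_a; apply: subsemigroupM; rewrite ?mergeN ?IHm // (leq_trans lt_pa).
have [coker_a|/split_ker[i [j [ij def_a lt_pa]]]] :=
  boolP (trivial_rel (ptn_ker a^-1)); last first.
  rewrite -[a]invgK def_a invMg; apply: subsemigroupM => //.
    by apply: IHm; rewrite star_card (leq_trans lt_pa) // star_card.
  by rewrite merge_star mergeN.
exact: partial_permN ker_a coker_a.
Qed.

(** * Units *)

Lemma perm_ptn_unit s : perm_ptn s \in sym_units n.
Proof. by apply/sym_unitsP; exists s. Qed.

Lemma unit_star a : (a^-1 \in sym_units n) = (a \in sym_units n).
Proof.
have star b : b \in sym_units n -> b^-1 \in sym_units n.
  by case/sym_unitsP=> s ->; rewrite -perm_ptnV perm_ptn_unit.
by apply/idP/idP=> /star; rewrite ?invgK.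
Qed.

Lemma perm_ptnK s : perm_ptn s * (perm_ptn s)^-1 = 1.
Proof. by rewrite -perm_ptnV -perm_ptnM mulgV perm_ptn1. Qed.

Lemma perm_ptnVK s : (perm_ptn s)^-1 * perm_ptn s = 1.
Proof. by rewrite -perm_ptnV -perm_ptnM mulVg perm_ptn1. Qed.

Lemma unit_rank_dom_ker a : a \in sym_units n ->
  [/\ ptn_rank a = n, ptn_dom a = setT & trivial_rel (ptn_ker a)].
Proof.
case/sym_unitsP=> s ->.
have dom_s : ptn_dom (perm_ptn s) = setT.
  apply/setP=> i; rewrite in_setT; apply/ptn_domP; exists (s i).
  by rewrite fiber_rel.
have ker_s : trivial_rel (ptn_ker (perm_ptn s)).
  by apply/trivial_kerP=> i j; rewrite /ptn_ker fiber_rel => /eqP/perm_inj.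
by split=> //; rewrite ptn_rank_trivial_ker // dom_s cardsT card_ord.
Qed.

(** The non-units form an ideal. *)
Lemma unit_mul a b :
  (a * b \in sym_units n) = (a \in sym_units n) && (b \in sym_units n).
Proof.
have unitl c d : c * d \in sym_units n -> c \in sym_units n.
  case/unit_rank_dom_ker=> _ dom_cd /trivial_kerP ker_cd.
  apply/sym_unitsP; apply: trivial_ker_full_dom.
    by apply/trivial_kerP=> i j ij; apply/ker_cd/ptn_ker_mul.
  by apply/eqP; rewrite -subTset -dom_cd ptn_dom_mul.
apply/idP/andP=> [ab|[/sym_unitsP[s ->] /sym_unitsP[t ->]]].
  split; first exact: unitl ab.
  by rewrite -unit_star; apply: (@unitl _ a^-1); rewrite -invMg unit_star.
by rewrite -perm_ptnM perm_ptn_unit.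
Qed.

(** * The four critical sets *)

(** The adjectives upper and lower refer to unprimed and primed points. In rank
    [n - 1], a trivial kernel means that exactly one point is outside the domain,
    and a full domain that exactly two points are identified. *)
Definition upper_punctured : {set ptn n} :=
  [set a | (ptn_rank a == n - 1)%N && trivial_rel (ptn_ker a)].

Definition upper_merged : {set ptn n} :=
  [set a | (ptn_rank a == n - 1)%N && (ptn_dom a == [set: 'I_n])].

Definition lower_punctured : {set ptn n} :=
  [set a | (ptn_rank a == n - 1)%N && trivial_rel (ptn_coker a)].

Definition lower_merged : {set ptn n} :=
  [set a | (ptn_rank a == n - 1)%N && (ptn_codom a == [set: 'I_n])].

Lemma lower_puncturedE a : (a \in lower_punctured) = (a^-1 \in upper_punctured).
Proof. by rewrite !in_set ptn_rank_star. Qed.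

Lemma lower_mergedE a : (a \in lower_merged) = (a^-1 \in upper_merged).
Proof. by rewrite !in_set ptn_rank_star. Qed.

Hypothesis n_gt1 : 1 < n.

Let n_gt0 : 0 < n. Proof. exact: ltnW. Qed.

Lemma in_upper_punctured a :
  reflect (exists i, a * a^-1 = puncture i) (a \in upper_punctured).
Proof. by rewrite in_set; apply: upper_punctureP. Qed.

Lemma in_upper_merged a :
  reflect (exists i j, i != j /\ a * a^-1 = merge i j) (a \in upper_merged).
Proof. by rewrite in_set; apply: upper_mergeP. Qed.

Lemma in_lower_punctured a :
  reflect (exists i, a^-1 * a = puncture i) (a \in lower_punctured).
Proof.
by rewrite lower_puncturedE; have := in_upper_punctured a^-1; rewrite invgK.
Qed.

Lemma in_lower_merged a :
  reflect (exists i j, i != j /\ a^-1 * a = merge i j) (a \in lower_merged).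
Proof.
by rewrite lower_mergedE; have := in_upper_merged a^-1; rewrite invgK.
Qed.

Lemma rank_pred_upper a : (ptn_rank a = n - 1)%N ->
  (a \in upper_punctured) || (a \in upper_merged).
Proof.
move=> rk_a; rewrite !in_set rk_a eqxx /=.
have [_|domN] := eqVneq (ptn_dom a) setT; rewrite ?orbT // orbF.
have rk_le : #|upper_class a @: ptn_dom a| <= #|ptn_dom a| by apply: leq_imset_card.
have dom_lt : #|ptn_dom a| < n by rewrite -[X in _ < X]card_ord -cardsT proper_card // properT.
have card_dom : #|ptn_dom a| = (n - 1)%N.
  apply/eqP; rewrite eqn_leq -{2}rk_a ptn_rankE rk_le andbT.
  by rewrite -ltnS subn1 prednK.
have /imset_injP cl_inj : #|upper_class a @: ptn_dom a| == #|ptn_dom a|.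
  by rewrite -ptn_rankE rk_a card_dom.
have /eqP/cards1P[k dom_k] : #|~: ptn_dom a| = 1%N.
  by rewrite cardsCs setCK card_ord card_dom subKn.
have in_domC i : (i \notin ptn_dom a) = (i == k) by rewrite -in_setC dom_k in_set1.
apply/trivial_kerP=> i j ij; have [ia|] := boolP (i \in ptn_dom a).
  by apply: cl_inj => //; [rewrite -(ptn_dom_ker ij) | apply/eqP; rewrite upper_class_eq].
move=> /[dup]; rewrite {2}(ptn_dom_ker ij) !in_domC.
by move=> /eqP-> /eqP->.
Qed.

Lemma rank_pred_lower a : (ptn_rank a = n - 1)%N ->
  (a \in lower_punctured) || (a \in lower_merged).
Proof.
by move=> rk_a; rewrite lower_puncturedE lower_mergedE rank_pred_upper ?ptn_rank_star.
Qed.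

Section Representatives.

Variables (i j : 'I_n) (ij : i != j).

Lemma puncture_upper : puncture i \in upper_punctured.
Proof. by apply/in_upper_punctured; exists i; rewrite puncture_proj. Qed.

Lemma merge_upper : merge i j \in upper_merged.
Proof. by apply/in_upper_merged; exists i, j; rewrite merge_proj. Qed.

Lemma contract_upper : contract i j \in upper_merged.
Proof. by apply/in_upper_merged; exists i, j; rewrite contract_star_r. Qed.

Lemma contract_lower : contract i j \in lower_punctured.
Proof. by apply/in_lower_punctured; exists i; rewrite contract_star_l. Qed.

End Representatives.

Lemma upper_disjoint a : a \in upper_punctured -> a \notin upper_merged.
Proof.
case/in_upper_punctured=> i ai; apply/negP=> /in_upper_merged[k [l [_ akl]]].
have : ptn_dom (puncture i) = setT by rewrite -ai akl dom_merge.
by move/setP/(_ i); rewrite dom_puncture in_setC1 in_setT eqxx.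
Qed.

Lemma lower_disjoint a : a \in lower_punctured -> a \notin lower_merged.
Proof. by rewrite lower_puncturedE lower_mergedE; apply: upper_disjoint. Qed.

(** The sets whose complements are the maximal subsemigroups containing the
    units. *)
Definition critical_sets : seq {set ptn n} :=
  [:: upper_punctured; upper_merged; lower_punctured; lower_merged].

(** Each row lists the membership of one partition in the four sets, in their
    order in [critical_sets]; the witnesses are a [puncture], a [merge], a
    [contract] and the star of a [contract]. *)
Lemma critical_sets_table : exists p m c d : ptn n,
  [/\ [seq p \in X | X : {set ptn n} <- critical_sets] = [:: true; false; true; false],
      [seq m \in X | X : {set ptn n} <- critical_sets] = [:: false; true; false; true],
      [seq c \in X | X : {set ptn n} <- critical_sets] = [:: false; true; true; false]
    & [seq d \in X | X : {set ptn n} <- critical_sets] = [:: true; false; false; true]].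
Proof.
pose i := Ordinal n_gt0; pose j := Ordinal n_gt1; have ij : i != j by [].
have upP := puncture_upper i; have upM := merge_upper ij.
have upC := contract_upper ij; have loC := contract_lower ij.
have upN a : a \in upper_merged -> a \in upper_punctured = false.
  by move=> aM; apply: contraTF aM; apply: upper_disjoint.
exists (puncture i), (merge i j), (contract i j), (contract i j)^-1.
rewrite /= !lower_puncturedE !lower_mergedE invgK puncture_star merge_star.
rewrite upP upM upC -lower_puncturedE loC !upN //.
by rewrite (negbTE (upper_disjoint upP)) -lower_mergedE (negbTE (lower_disjoint loC)).
Qed.

Lemma critical_sets_uniq : uniq critical_sets.
Proof.
have [p [_ [c [_ [[p1 p2 p3 p4] _ [c1 c2 c3 c4] _]]]]] := critical_sets_table.
apply: (@map_uniq _ _ (fun X : {set ptn n} => (p \in X, c \in X))).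
by rewrite /= p1 p2 p3 p4 c1 c2 c3 c4.
Qed.

Lemma critical_sets_incomparable X Y :
  X \in critical_sets -> Y \in critical_sets -> Y \subset X -> Y = X.
Proof.
have [p [m [c [d [[P1 P2 P3 P4] [M1 M2 M3 M4] [C1 C2 C3 C4] [D1 D2 D3 D4]]]]]] :=
  critical_sets_table.
rewrite !inE => /or4P[]/eqP-> /or4P[]/eqP-> // /subsetP sYX.
(* When [Y] differs from [X], one of the four witnesses is in [Y] but not in [X]. *)
all: have := sYX p; have := sYX m; have := sYX c; have := sYX d.
all: rewrite ?P1 ?P2 ?P3 ?P4 ?M1 ?M2 ?M3 ?M4 ?C1 ?C2 ?C3 ?C4 ?D1 ?D2 ?D3 ?D4.
all: move=> h1 h2 h3 h4.
all: by first [case: (notF (h1 isT)) | case: (notF (h2 isT))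
             | case: (notF (h3 isT)) | case: (notF (h4 isT))].
Qed.

(** * Subsemigroups containing the units *)

Lemma perm_ptnVKz s a : (perm_ptn s)^-1 * (perm_ptn s * a) = a.
Proof. by rewrite mulgA perm_ptnVK mul1g. Qed.

Section ContainingUnits.

Variable N : {set ptn n}.
Hypotheses (sgN : subsemigroup N) (unitN : sym_units n \subset N).

Let permN s : perm_ptn s \in N.
Proof. exact/(subsetP unitN)/perm_ptn_unit. Qed.

(** When [a * a^-1] and [a^-1 * a] are conjugate under the unit [perm_ptn s],
    the product [a * perm_ptn s] lies in a group with identity [a * a^-1]. *)
Lemma projection_mem a s : a \in N ->
  perm_ptn s * (a * a^-1) * (perm_ptn s)^-1 = a^-1 * a -> a * a^-1 \in N.
Proof.
move=> aN conj_a; pose b := a * perm_ptn s.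
have bV : b * b^-1 = a * a^-1.
  by rewrite /b invMg !mulgA -(mulgA a) perm_ptnK mulg1.
have Vb : b^-1 * b = a * a^-1.
  by rewrite /b invMg -!mulgA (mulgA a^-1) -conj_a -!mulgA perm_ptnVKz perm_ptnVK mulg1.
have bb : b * (a * a^-1) = b by rewrite -Vb mulgA mul_starK.
have [k <-] := expg_star bV Vb bb.
by apply: subsemigroupX => //; apply: subsemigroupM.
Qed.

Lemma puncture_mem a i : a \in N -> a \in upper_punctured -> a \in lower_punctured ->
  puncture i \in N.
Proof.
move=> aN /in_upper_punctured[k aV] /in_lower_punctured[l Va].
have [s sP] := puncture_conjugate k l; have [t <-] := puncture_conjugate k i.
rewrite -perm_ptnV; do 2 apply: subsemigroupM => //.
by rewrite -aV; apply: (@projection_mem _ s); rewrite ?aV ?Va.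
Qed.

Lemma merge_mem a i j : a \in N -> a \in upper_merged -> a \in lower_merged ->
  i != j -> merge i j \in N.
Proof.
move=> aN /in_upper_merged[k [l [kl aV]]] /in_lower_merged[p [q [pq Va]]] ij.
have [s sP] := merge_conjugate kl pq; have [t <-] := merge_conjugate kl ij.
rewrite -perm_ptnV; do 2 apply: subsemigroupM => //.
by rewrite -aV; apply: (@projection_mem _ s); rewrite ?aV ?Va.
Qed.

(** If the lower pattern of [a] is conjugate to the upper pattern of [c], then
    some product [a u c], with [u] a unit, has the upper pattern of [a] and the
    lower pattern of [c]. *)
Lemma link_mem a c s : a \in N -> c \in N ->
    perm_ptn s * (c * c^-1) * (perm_ptn s)^-1 = a^-1 * a ->
  exists d, [/\ d \in N, d * d^-1 = a * a^-1 & d^-1 * d = c^-1 * c].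
Proof.
move=> aN cN sP; 
have sPz (z : ptn n) : a^-1 * (a * z) = perm_ptn s * (c * (c^-1 * ((perm_ptn s)^-1 * z))).
  by rewrite mulgA -sP -!mulgA.
exists (a * perm_ptn s * c); split.
- by do 2 apply: subsemigroupM => //.
- by rewrite !invMg -!mulgA -sPz !mulgA mul_starK.
- by rewrite !invMg -!mulgA sPz !perm_ptnVKz (mulgA c) mul_starK.
Qed.

Lemma rank_critical_sets X a : X \in critical_sets -> a \in X -> (ptn_rank a = n - 1)%N.
Proof.
by rewrite !inE => /or4P[]/eqP->; rewrite in_set => /andP[/eqP].
Qed.

Lemma containing_units_cases : N = setT \/ exists2 X, X \in critical_sets & N \subset ~: X.
Proof.
have [/hasP[X X4 NX]|/hasPn avoids] := boolP (has (fun X => N \subset ~: X) critical_sets).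
  by right; exists X.
have meets X : X \in critical_sets -> exists2 a, a \in N & a \in X.
  by move/avoids/subsetPn=> [a aN]; rewrite in_setC negbK; exists a.
pose meet (X Y : {set ptn n}) := exists a, [/\ a \in N, a \in X & a \in Y].
suff [[p [pN pU pL]] [m [mN mU mL]]] :
    meet upper_punctured lower_punctured /\ meet upper_merged lower_merged.
  left; apply/setP=> a; rewrite in_setT; apply: ptn_generation => // [i|i j ij].
    exact: (puncture_mem i pN).
  exact: (merge_mem mN).
have [UM4 UP4 LM4 LP4] : [/\ upper_merged \in critical_sets, upper_punctured \in critical_sets,
    lower_merged \in critical_sets & lower_punctured \in critical_sets].
  by rewrite !inE !eqxx ?orbT.
have rk X a X4 aX := rank_critical_sets (X := X) (a := a) X4 aX.
have [a aN aU] := meets _ UP4; have [b bN bL] := meets _ LM4.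
have [c cN cU] := meets _ UM4; have [d dN dL] := meets _ LP4.
(* Elements of [N] of the two mixed kinds produce elements of [N] with the same
   kind of pattern on both sides. *)
have mixed (x y : ptn n) : x \in N -> x \in upper_punctured -> x \in lower_merged ->
    y \in N -> y \in upper_merged -> y \in lower_punctured ->
    meet upper_punctured lower_punctured /\ meet upper_merged lower_merged.
  move=> xN /in_upper_punctured[i xV] /in_lower_merged[k [l [kl Vx]]].
  move=> yN /in_upper_merged[p [q [pq yV]]] /in_lower_punctured[j Vy].
  have [s sP] := merge_conjugate pq kl; have [t tP] := puncture_conjugate i j.
  have [|u [uN uV Vu]] := @link_mem x y s xN yN; first by rewrite yV Vx.
  have [|v [vN vV Vv]] := @link_mem y x t yN xN; first by rewrite xV Vy.
  split; [exists u | exists v]; split=> //.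
  - by apply/in_upper_punctured; exists i; rewrite uV.
  - by apply/in_lower_punctured; exists j; rewrite Vu.
  - by apply/in_upper_merged; exists p, q; rewrite vV.
  - by apply/in_lower_merged; exists k, l; rewrite Vv.
have [aL|aL] := orP (rank_pred_lower (rk _ _ UP4 aU)).
  have [cL|cL] := orP (rank_pred_lower (rk _ _ UM4 cU)).
    have [bU|bU] := orP (rank_pred_upper (rk _ _ LM4 bL)).
      exact: (mixed b c).
    by split; [exists a | exists b].
  by split; [exists a | exists c].
have [cL|cL] := orP (rank_pred_lower (rk _ _ UM4 cU)).
  exact: (mixed a c).
have [dU|dU] := orP (rank_pred_upper (rk _ _ LP4 dL)).
  by split; [exists d | exists c].
exact: (mixed a d).
Qed.

End ContainingUnits.

(** * The maximal subsemigroups *)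

Lemma critical_sets_not_unit X a : X \in critical_sets -> a \in X -> a \notin sym_units n.
Proof.
move=> X4 /(rank_critical_sets X4) rk_a; apply/negP=> /unit_rank_dom_ker[rk _ _].
by move: rk; rewrite rk_a subn1 => /eqP; rewrite ltn_eqF // ltn_predL.
Qed.

Lemma critical_sets_nonempty X : X \in critical_sets -> X != set0.
Proof.
move=> X4; have : X \in critical_sets := X4.
pose i := Ordinal n_gt0; pose j := Ordinal n_gt1; have ij : i != j by [].
rewrite !inE => /or4P[]/eqP->; apply/set0Pn.
- by exists (puncture i); apply: puncture_upper.
- by exists (merge i j); apply: merge_upper.
- by exists (contract i j); apply: contract_lower.
- by exists (merge i j); rewrite lower_mergedE merge_star merge_upper.
Qed.

(** The complement of a critical set is a subsemigroup. *)
Lemma critical_sets_prime X a b : X \in critical_sets -> a * b \in X ->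
  (a \in X) || (b \in X).
Proof.
(* If [c] is a unit, [d] has the pattern of [c * d] up to conjugation; otherwise
   [c] has rank [n - 1], and has the kernel or the domain required of [c * d]. *)
have upper (Y : {set ptn n}) c d : Y \in [:: upper_punctured; upper_merged] ->
    c * d \in Y -> (c \in Y) || (d \in Y).
  move=> Y2 cdY; have rk_cd : ptn_rank (c * d) = (n - 1)%N.
    by apply: rank_critical_sets cdY; move: Y2; rewrite !inE => /orP[]->; rewrite ?orbT.
  have [cU|cU] := boolP (c \in sym_units n).
    rewrite orbC; apply/orP; left; case/sym_unitsP: cU cdY => s -> {rk_cd}.
    have def_d : d = (perm_ptn s)^-1 * (perm_ptn s * d) by rewrite perm_ptnVKz.
    set e := perm_ptn s * d in def_d *.
    have dV : d * d^-1 = perm_ptn s^-1 * (e * e^-1) * (perm_ptn s^-1)^-1.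
      by rewrite perm_ptnV def_d invMg !mulgA.
    move: Y2; rewrite !inE => /orP[]/eqP->.
      case/in_upper_punctured=> i eV; apply/in_upper_punctured; exists (s i).
      by rewrite dV eV; apply: puncture_conj; rewrite permK.
    case/in_upper_merged=> i [j [ij eV]]; apply/in_upper_merged; exists (s i), (s j).
    by rewrite (inj_eq perm_inj) dV eV; split=> //; apply: merge_conj; rewrite permK.
  have rk_c : ptn_rank c = (n - 1)%N.
    apply/eqP; rewrite eqn_leq -{2}rk_cd ptn_rank_mull andbT -ltnS subn1 prednK //.
    have := leq_trans (leq_imset_card (upper_class c) (mem (ptn_dom c))) (max_card _).
    rewrite card_ord ltn_neqAle ptn_rankE => ->; rewrite andbT -ptn_rankE.
    by apply: contra cU => /eqP; apply: unit_rank.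
  move: Y2 cdY; rewrite !inE => /orP[]/eqP->; rewrite !in_set rk_c eqxx /=.
    case/andP=> _ /trivial_kerP ker_cd; apply/orP; left; apply/trivial_kerP=> i j ij.
    exact/ker_cd/ptn_ker_mul.
  case/andP=> _ /eqP dom_cd; apply/orP; left.
  by rewrite -subTset -dom_cd ptn_dom_mul.
rewrite !inE => /or4P[]/eqP->; rewrite ?lower_puncturedE ?lower_mergedE ?invMg.
- by apply: upper; rewrite !inE eqxx.
- by apply: upper; rewrite !inE eqxx orbT.
- by rewrite orbC; apply: upper; rewrite !inE eqxx.
- by rewrite orbC; apply: upper; rewrite !inE eqxx orbT.
Qed.

Lemma maximal_critical_sets X : X \in critical_sets -> maximal_subsemigroup (~: X).
Proof.
move=> X4; apply/maximal_subsemigroupP; split.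
- apply/subsemigroupP=> a b; rewrite !in_setC => aX bX.
  by apply/negP=> /(critical_sets_prime X4); rewrite (negbTE aX) (negbTE bX).
- by rewrite -setC0 (inj_eq (@setC_inj _)) critical_sets_nonempty.
move=> B sgB nB XB; have unitB : sym_units n \subset B.
  apply: subset_trans XB; apply/subsetP=> a; rewrite in_setC.
  by apply: contraL; apply: critical_sets_not_unit.
have [BT|[Y Y4 BY]] := containing_units_cases sgB unitB; first by rewrite BT eqxx in nB.
have YX : Y = X.
  by apply: critical_sets_incomparable; rewrite // -setCS (subset_trans XB).
by apply/eqP; rewrite eqEsubset XB -YX BY.
Qed.


Implicit Types (A B U V X : {set ptn n}).

(** Below, [~: sym_units n :|: U] adjoins a set [U] of units to the ideal of
    non-units. *)
Lemma subsemigroup_nonunitsU U :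
  U \subset sym_units n -> subsemigroup U -> subsemigroup (~: sym_units n :|: U).
Proof.
move=> /subsetP US /subsemigroupP sgU; apply/subsemigroupP=> a b.
rewrite !in_setU !in_setC unit_mul negb_and.
move=> /orP[->//|aU] /orP[->|bU]; first by rewrite orbT.
by rewrite sgU ?orbT.
Qed.

Lemma nonunitsUK U : U \subset sym_units n ->
  (~: sym_units n :|: U) :&: sym_units n = U.
Proof. by move=> US; rewrite setIUl [~: _ :&: _]setIC setICr set0U; apply/setIidPl. Qed.

Lemma nonunitsU_neqT U : U \subset sym_units n ->
  (~: sym_units n :|: U != setT) = (U != sym_units n).
Proof.
move=> US; congr (~~ _); apply/eqP/eqP=> [UT|->]; last by rewrite setUC setUCr.
by rewrite -(nonunitsUK US) UT setTI.
Qed.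

Lemma unit_power a : a \in sym_units n -> exists k : nat, a ^+ k.+1 = 1.
Proof.
case/sym_unitsP=> s ->.
exact: expg_star (perm_ptnK s) (perm_ptnVK s) (mulg1 _).
Qed.

Lemma subgroup_of_units V :
  V \subset sym_units n -> subsemigroup V -> 1 \in V -> subgroup V.
Proof.
move=> /subsetP VS sgV V1; apply/and3P; split=> //; apply/forall_inP=> a aV.
have [k ak] := unit_power (VS _ aV); apply/exists_inP; exists (a ^+ k).
  by case: k {ak} => [|k]; [rewrite expg0 | apply: subsemigroupX].
by rewrite -expgS -expgSr ak eqxx.
Qed.

Lemma maximal_subgroupP (G U : {set ptn n}) :
  reflect [/\ subgroup U, U \proper G
            & forall V, subgroup V -> V \proper G -> U \subset V -> V = U]
          (maximal_subgroup G U).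
Proof.
apply: (iffP maxsetP) => /= [[/andP[sgU UG] maxU]|[sgU UG maxU]].
  by split=> // V sgV VG; apply: maxU; rewrite sgV.
by split=> [|V /andP[sgV VG]]; [rewrite sgU | apply: maxU].
Qed.

Lemma maximal_nonunitsU U : maximal_subgroup (sym_units n) U ->
  maximal_subsemigroup (~: sym_units n :|: U).
Proof.
case/maximal_subgroupP=> /and3P[U1 sgU _] /andP[US nUS] maxU.
have neqP V : V \subset sym_units n -> (V \proper sym_units n) = (V != sym_units n).
  by move=> VS; rewrite properEneq VS andbT.
apply/maximal_subsemigroupP; split; first exact: subsemigroup_nonunitsU.
  by rewrite nonunitsU_neqT // -neqP // /proper US.
move=> B sgB nB sUB; pose V := B :&: sym_units n.
have VS : V \subset sym_units n by apply: subsetIr.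
have UV : U \subset V by rewrite subsetI US (subset_trans _ sUB) ?subsetUr.
have def_B : B = ~: sym_units n :|: V.
  rewrite setUIr [_ :|: sym_units n]setUC setUCr setIT.
  exact/esym/setUidPr/(subset_trans _ sUB)/subsetUl.
rewrite {1}def_B (maxU V) //.
  apply: subgroup_of_units; rewrite ?(subsetP UV) //; apply/subsemigroupP=> a b.
  rewrite !in_setI unit_mul => /andP[aB ->] /andP[bB ->].
  by rewrite subsemigroupM.
by rewrite neqP // -nonunitsU_neqT // -def_B.
Qed.

Lemma maximal_not_containing_units A :
    maximal_subsemigroup A -> ~~ (sym_units n \subset A) ->
  maximal_subgroup (sym_units n) (A :&: sym_units n)
  /\ A = ~: sym_units n :|: (A :&: sym_units n).
Proof.
case/maximal_subsemigroupP=> sgA _ maxA nSA; set U := A :&: _.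
have US : U \subset sym_units n by apply: subsetIr.
have sgU : subsemigroup U.
  apply/subsemigroupP=> a b; rewrite !in_setI unit_mul => /andP[aA ->] /andP[bA ->].
  by rewrite subsemigroupM.
have nUS : U != sym_units n.
  by apply: contra nSA => /eqP <-; apply: subsetIl.
have def_A : A = ~: sym_units n :|: U.
  apply/esym/maxA; rewrite ?nonunitsU_neqT ?subsemigroup_nonunitsU //.
  by rewrite setUIr [_ :|: sym_units n]setUC setUCr setIT subsetUr.
have U1 : 1 \in U.
  (* Were [U] empty, [A] would be the set of non-units, and adjoining the identity
     would give a larger proper subsemigroup, since [n >= 2]. *)
  have [U0|[a aU]] := set_0Vmem U; last first.
    by have [k <-] := unit_power (subsetP US _ aU); apply: subsemigroupX.
  have S1 : [set 1] \subset sym_units n by rewrite sub1set -perm_ptn1 perm_ptn_unit.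
  have sg1 : subsemigroup [set 1 : ptn n].
    by apply/subsemigroupP=> a b; rewrite !in_set1 => /eqP-> /eqP->; rewrite mulg1.
  have nS1 : [set 1] != sym_units n.
    pose i := Ordinal n_gt0; pose j := Ordinal n_gt1; have ij : i != j by [].
    apply/eqP=> /setP/(_ (perm_ptn (tperm i j))).
    rewrite perm_ptn_unit in_set1 -perm_ptn1 (inj_eq perm_ptn_inj).
    by move/eqP/permP/(_ i)/eqP; rewrite tpermL perm1 eq_sym (negbTE ij).
  have eq_A : ~: sym_units n :|: [set 1] = A.
    apply: maxA; rewrite ?nonunitsU_neqT ?subsemigroup_nonunitsU //.
    by rewrite def_A U0 setU0 subsetUl.
  by rewrite in_setI -{1}eq_A in_setU in_set1 eqxx orbT (subsetP S1) ?in_set1.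
split=> //; apply/maximal_subgroupP; split=> [||V /and3P[V1 sgV _]].
- exact: subgroup_of_units.
- by rewrite properEneq nUS.
rewrite properEneq => /andP[nVS VS] UV.
rewrite /U -(@maxA (~: sym_units n :|: V)) ?nonunitsU_neqT
  ?subsemigroup_nonunitsU ?nonunitsUK //.
by rewrite def_A setUS.
Qed.

Lemma maximal_subsemigroup_cases A : maximal_subsemigroup A <->
  (exists2 U, maximal_subgroup (sym_units n) U & A = ~: sym_units n :|: U)
  \/ (exists2 X, X \in critical_sets & A = ~: X).
Proof.
split=> [maxA|[[U maxU ->]|[X X4 ->]]]; last 2 first.
- exact: maximal_nonunitsU.
- exact: maximal_critical_sets.
have [SA|nSA] := boolP (sym_units n \subset A); last first.
  by left; have [] := maximal_not_containing_units maxA nSA; exists (A :&: sym_units n).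
case/maximal_subsemigroupP: (maxA) => sgA nA max_A; right.
have [AT|[X X4 AX]] := containing_units_cases sgA SA; first by rewrite AT eqxx in nA.
have /maximal_subsemigroupP[sgX nX _] := maximal_critical_sets X4.
by exists X => //; apply/esym/max_A.
Qed.

(** * Counting *)

Lemma sym_unitsE : sym_units n = perm_ptn @: [set: 'S_n].
Proof.
apply/setP=> a; apply/sym_unitsP/imsetP=> [[s ->]|[s _ ->]]; last by exists s.
by exists s; rewrite ?in_setT.
Qed.

Lemma subgroup_imset_perm (G : {group 'S_n}) : subgroup (perm_ptn @: G).
Proof.
apply: subgroup_of_units.
- by rewrite sym_unitsE imsetS ?subsetT.
- apply/subsemigroupP=> _ _ /imsetP[s sG ->] /imsetP[t tG ->].
  by rewrite -perm_ptnM imset_f ?groupM.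
- by rewrite -perm_ptn1 imset_f ?group1.
Qed.

Lemma subgroup_units_group V : subgroup V -> V \subset sym_units n ->
  exists G : {group 'S_n}, V = perm_ptn @: G.
Proof.
case/and3P=> V1 sgV _ VS.
have gV : group_set (perm_ptn @^-1: V).
  apply/group_setP; split=> [|s t]; rewrite !in_set; first by rewrite perm_ptn1.
  by rewrite perm_ptnM; apply: subsemigroupM.
exists (Group gV); apply/setP=> a; apply/idP/imsetP=> [aV|[s + ->]]; last by rewrite in_set.
by have /sym_unitsP[s def_a] := subsetP VS _ aV; exists s; rewrite // in_set -def_a.
Qed.

Lemma card_maximal_subgroups :
  #|[set U | maximal_subgroup (sym_units n) U]|
  = #|[set G : {group 'S_n} | maximal G [set: 'S_n]]|.
Proof.
pose f (G : {group 'S_n}) := perm_ptn @: G.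
have f_inj : injective f by move=> G H /(imset_inj perm_ptn_inj)/group_inj.
have f_sub G H : (f G \subset f H) = (G \subset H).
  apply/idP/idP=> [/subsetP GH|]; last exact: imsetS.
  apply/subsetP=> s sG; have := GH _ (imset_f perm_ptn sG).
  by rewrite (mem_imset _ _ perm_ptn_inj).
have f_proper G : (f G \proper sym_units n) = (G \proper [set: 'S_n]).
  by rewrite sym_unitsE /proper -!(f_sub _ [set: 'S_n]%G) -!(f_sub [set: 'S_n]%G).
rewrite -(card_imset _ f_inj); congr #|pred_of_set _|; apply/setP=> U; rewrite in_set.
apply/idP/imsetP=> [maxU|[G + ->]].
  case/maximal_subgroupP: maxU => sgU US maxU.
  have [G def_U] := subgroup_units_group sgU (proper_sub US).
  exists G => //; rewrite in_set; apply/maxgroupP; split=> [|H HT GH].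
    by rewrite -f_proper -[f G]def_U.
  apply: (imset_inj perm_ptn_inj); rewrite -def_U; apply: maxU; rewrite ?f_proper //.
    exact: subgroup_imset_perm.
  by rewrite def_U f_sub.
rewrite in_set => /maxgroupP[GT maxG]; apply/maximal_subgroupP; split.
- exact: subgroup_imset_perm.
- by rewrite f_proper.
move=> V sgV VS; have [H def_V] := subgroup_units_group sgV (proper_sub VS).
rewrite def_V -!/(f _) f_sub => GH; rewrite /f maxG //.
by rewrite -f_proper /f -def_V.
Qed.

Lemma card_maximal_subsemigroups :
  #|[set A : {set ptn n} | maximal_subsemigroup A]|
  = (#|[set G : {group 'S_n} | maximal G [set: 'S_n]]| + 4)%N.
Proof.
pose h U := ~: sym_units n :|: U.
have -> : [set A : {set ptn n} | maximal_subsemigroup A] =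
    h @: [set U | maximal_subgroup (sym_units n) U] :|: [set ~: X | X in critical_sets].
  apply/setP=> A; rewrite in_set in_setU; apply/idP/orP.
    case/maximal_subsemigroup_cases=> [[U maxU ->]|[X X4 ->]]; last by right; apply: imset_f.
    by left; apply: imset_f; rewrite in_set.
  case=> /imsetP[X + ->]; last exact: maximal_critical_sets.
  by rewrite in_set; apply: maximal_nonunitsU.
(* The union is disjoint: the second family consists of sets containing all
   units, the first of sets that miss some unit. *)
rewrite cardsU card_in_imset => [|U V]; last first.
  rewrite !in_set => /maximal_subgroupP[_ /proper_sub US _].
  case/maximal_subgroupP=> [_ /proper_sub VS _] UV.
  by rewrite -(nonunitsUK US) -(nonunitsUK VS) -/(h U) UV.
rewrite card_maximal_subgroups card_imset; last exact: setC_inj.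
rewrite (card_uniqP critical_sets_uniq).
rewrite [X in _ - X](_ : _ = 0%N) ?subn0 //; apply/eqP; rewrite cards_eq0.
apply/set0Pn=> -[A]; rewrite in_setI => /andP[/imsetP[U + ->] /imsetP[X X4]].
rewrite in_set => /maximal_subgroupP[_ /andP[_ /subsetPn[a aS aU]] _] /setP/(_ a).
rewrite in_setU !in_setC aS (negbTE aU) => /esym/negbFE aX.
by have := critical_sets_not_unit X4 aX; rewrite aS.
Qed.

(** * Green's classes and types *)

Lemma ptn_regular (J : {set ptn n}) : regular J.
Proof.
by apply/forall_inP=> a _; apply/existsP; exists a^-1; rewrite mul_starK.
Qed.

Lemma type_M5_nonunitsU U : maximal_subgroup (sym_units n) U ->
  type_M5 (~: sym_units n :|: U).
Proof.
case/maximal_subgroupP=> /and3P[U1 _ _] _ _.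
have unitV a : a \in sym_units n -> a * a^-1 = 1 /\ a^-1 * a = 1.
  by case/sym_unitsP=> s ->; rewrite perm_ptnK perm_ptnVK.
apply/existsP; exists (Jclass 1); rewrite ptn_regular /=.
apply/andP; split.
  apply/andP; split; first by rewrite imset_f.
  apply/subsetP=> a; rewrite in_setC in_setU in_setC negb_or negbK => /andP[aS _].
  rewrite mem_Jclass; apply/andP; split; apply/principal_idealP.
    by exists a, 1; rewrite !mulg1.
  by exists a^-1, 1; rewrite mulg1; have [_ ->] := unitV a aS.
apply/forall_inP=> a; rewrite mem_Jclass => /andP[_ /principal_idealP[x [y xay]]].
have [aV Va] : a * a^-1 = 1 /\ a^-1 * a = 1.
  apply: unitV; have: 1 \in sym_units n by rewrite -perm_ptn1 perm_ptn_unit.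
  by rewrite xay !unit_mul => /andP[/andP[]].
apply/set0Pn; exists 1; rewrite !in_setI in_setU U1 orbT /=.
apply/andP; split; [apply/LclassP|apply/RclassP]; split.
- by exists a^-1.
- by exists a; rewrite mulg1.
- by exists a^-1.
- by exists a; rewrite mul1g.
Qed.

Lemma Jclass_star_r a : a * a^-1 \in Jclass a.
Proof.
rewrite mem_Jclass; apply/andP; split; apply/principal_idealP.
  by exists 1, a^-1; rewrite mul1g.
by exists 1, a; rewrite mul1g mul_starK.
Qed.

Lemma Jclass_star_l a : a^-1 * a \in Jclass a.
Proof.
rewrite mem_Jclass; apply/andP; split; apply/principal_idealP.
  by exists a^-1, 1; rewrite mulg1.
by exists a, 1; rewrite mulg1 mulgA mul_starK.
Qed.

Lemma Jclass_conj s a : perm_ptn s * a * (perm_ptn s)^-1 \in Jclass a.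
Proof.
rewrite mem_Jclass; apply/andP; split; apply/principal_idealP.
  by exists (perm_ptn s), (perm_ptn s)^-1.
exists (perm_ptn s)^-1, (perm_ptn s).
by rewrite -!mulgA perm_ptnVK perm_ptnVKz mulg1.
Qed.

Lemma Jclass_sym a b : (a \in Jclass b) = (b \in Jclass a).
Proof. by rewrite !mem_Jclass andbC. Qed.

(** The critical sets lie in one and the same [J]-class. *)
Lemma critical_sets_Jclass X a i : X \in critical_sets -> a \in X ->
  a \in Jclass (puncture i).
Proof.
have punctJ k : puncture k \in Jclass (puncture i).
  by have [s <-] := puncture_conjugate i k; apply: Jclass_conj.
have starJ : a * a^-1 \in Jclass (puncture i) -> a \in Jclass (puncture i).
  by move/Jclass_trans; apply; rewrite Jclass_sym Jclass_star_r.
move=> X4 aX; apply: starJ.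
have [/in_upper_punctured[k ->]//|/in_upper_merged[k [l [kl ->]]]] :=
  orP (rank_pred_upper (rank_critical_sets X4 aX)).
apply: Jclass_trans (punctJ k) _.
rewrite -(contract_star_l kl) -(contract_star_r kl).
apply: Jclass_trans (Jclass_star_r _).
by rewrite Jclass_sym Jclass_star_l.
Qed.

Lemma upper_Rclass X a b : X \in [:: upper_punctured; upper_merged] ->
  b \in Rclass a -> b \in X -> a \in X.
Proof.
move=> X2 /RclassP[[x def_b] [y def_a]].
have rk : ptn_rank a = ptn_rank b.
  by apply/eqP; rewrite eqn_leq {1}def_a def_b !ptn_rank_mull.
move: X2; rewrite !inE => /orP[]/eqP->; rewrite !in_set rk => /andP[-> /=].
  move/trivial_kerP=> ker_b; apply/trivial_kerP=> i j ij; apply: ker_b.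
  by rewrite def_b; apply: ptn_ker_mul.
by rewrite -!subTset def_b => /subset_trans->; rewrite ?ptn_dom_mul.
Qed.

Lemma star_Lclass a b : (b \in Lclass a) = (b^-1 \in Rclass a^-1).
Proof.
apply/LclassP/RclassP=> -[[x def_b] [y def_a]]; split.
- by exists x^-1; rewrite def_b invMg.
- by exists y^-1; rewrite [in LHS]def_a invMg.
- by exists x^-1; rewrite -[b]invgK def_b invMg invgK.
- by exists y^-1; rewrite -[a]invgK [in LHS]def_a invMg invgK.
Qed.

Lemma lower_Lclass X a b : X \in [:: lower_punctured; lower_merged] ->
  b \in Lclass a -> b \in X -> a \in X.
Proof.
rewrite star_Lclass => + ba; rewrite !inE => /orP[]/eqP->.
  by rewrite !lower_puncturedE; apply: (upper_Rclass _ ba); rewrite !inE eqxx.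
by rewrite !lower_mergedE; apply: (upper_Rclass _ ba); rewrite !inE eqxx orbT.
Qed.

Section Types.

Let i : 'I_n := Ordinal n_gt0.
Let J := Jclass (puncture i).

Lemma arises_critical_sets X : X \in critical_sets -> arises_from (~: X) J.
Proof.
move=> X4; rewrite /arises_from setCK imset_f //=.
by apply/subsetP=> a; apply: critical_sets_Jclass.
Qed.

Lemma critical_sets_complement_meets X : X \in critical_sets -> ~: X :&: J != set0.
Proof.
move=> X4; apply/set0Pn.
have [p [m [_ [_ [[P1 P2 P3 P4] [M1 M2 M3 M4] _ _]]]]] := critical_sets_table.
have pJ : p \in J by apply: (@critical_sets_Jclass upper_punctured); rewrite ?P1 // !inE eqxx.
have mJ : m \in J.
  by apply: (@critical_sets_Jclass upper_merged); rewrite ?M2 // !inE eqxx orbT.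
move: X4; rewrite !inE => /or4P[]/eqP->.
- by exists m; rewrite in_setI in_setC M1 mJ.
- by exists p; rewrite in_setI in_setC P2 pJ.
- by exists m; rewrite in_setI in_setC M3 mJ.
- by exists p; rewrite in_setI in_setC P4 pJ.
Qed.

Lemma type_M4_upper X : X \in [:: upper_punctured; upper_merged] ->
  type_M4 (~: X).
Proof.
move=> X2; have X4 : X \in critical_sets.
  by move: X2; rewrite !inE => /orP[]->; rewrite ?orbT.
apply/existsP; exists J; rewrite arises_critical_sets // ptn_regular /=.
apply: nonempty_union_of_classes; last exact: critical_sets_complement_meets.
  by move=> a; rewrite inE.
move=> a; rewrite in_setI in_setC => /andP[aX aJ]; apply/subsetP=> b ba.
rewrite in_setI in_setC (contra (upper_Rclass X2 ba)) //=.
exact: Jclass_trans aJ (subsetP (Rclass_sub_Jclass a) b ba).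
Qed.

Lemma type_M3_lower X : X \in [:: lower_punctured; lower_merged] ->
  type_M3 (~: X).
Proof.
move=> X2; have X4 : X \in critical_sets.
  by move: X2; rewrite !inE => /orP[]->; rewrite ?orbT.
apply/existsP; exists J; rewrite arises_critical_sets // ptn_regular /=.
apply: nonempty_union_of_classes; last exact: critical_sets_complement_meets.
  by move=> a; rewrite inE.
move=> a; rewrite in_setI in_setC => /andP[aX aJ]; apply/subsetP=> b ba.
rewrite in_setI in_setC (contra (lower_Lclass X2 ba)) //=.
exact: Jclass_trans aJ (subsetP (Lclass_sub_Jclass a) b ba).
Qed.

End Types.

End Partitions.

(** * Degree 1 *)

Section DegreeOne.

Let p : ptn 1 := puncture ord0.

(** In degree [1], the two partitions are [1] and the projection [p]. *)
Lemma ptn1_cases (a : ptn 1) : a = 1 \/ a = p.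
Proof.
have [dom0|dom0] := boolP (ord0 \in ptn_dom a); [left|right].
  have [j] := ptn_domP _ _ dom0; rewrite (ord1 j) => rel0.
  by apply: ptnP => -[i|i] [k|k]; rewrite one_rel (ord1 i) (ord1 k) ?rel0 ?ptn_refl // ptn_sym.
apply: ptnP => x y; rewrite puncture_rel (ord1 (unprime x)) eqxx andbF orbF.
apply/idP/eqP=> [|->]; last exact: ptn_refl.
case: x y => [i|i] [k|k]; rewrite (ord1 i) (ord1 k) // => rel0; case/negP: dom0.
  by apply/ptn_domP; exists ord0.
by apply/ptn_domP; exists ord0; apply: ptn_sym.
Qed.

Lemma ptn1_neq : p != 1.
Proof.
apply/eqP=> /(congr1 (@ptn_dom 1))/setP/(_ ord0).
rewrite dom_puncture in_setC1 eqxx => /esym/negP[]; apply/ptn_domP; exists ord0.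
by rewrite one_rel.
Qed.

Lemma ptn1_mulC (a b : ptn 1) : a * b = b * a.
Proof. by case: (ptn1_cases a) (ptn1_cases b) => [->|->] [->|->]; rewrite ?mul1g ?mulg1. Qed.

Lemma ptn1_idem (a : ptn 1) : a * a = a.
Proof.
case: (ptn1_cases a) => ->; first exact: mulg1.
by rewrite -{2}[p]puncture_star puncture_proj.
Qed.

Lemma card_ptn1 : #|{: ptn 1}| = 2.
Proof.
rewrite -cardsT (_ : setT = [set p; 1]) ?cards2 ?ptn1_neq //.
by apply/esym/setP=> a; rewrite in_setT !inE; case: (ptn1_cases a) => ->; rewrite eqxx ?orbT.
Qed.

Lemma ptn1_maximal_subsemigroup (A : {set ptn 1}) :
  maximal_subsemigroup A <-> exists a : ptn 1, A = [set a].
Proof.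
have sg1 (a : ptn 1) : subsemigroup [set a].
  by apply/subsemigroupP=> b c; rewrite !in_set1 => /eqP-> /eqP->; rewrite ptn1_idem.
have ltT (B : {set ptn 1}) : B != setT -> #|B| <= 1.
  by rewrite -properT => /proper_card; rewrite cardsT card_ptn1.
have nT (a : ptn 1) : [set a] != setT.
  by apply/eqP=> /(congr1 (fun B : {set ptn 1} => #|B|)); rewrite cards1 cardsT card_ptn1.
split=> [/maximal_subsemigroupP[_ nA maxA]|[a ->]].
  have [A0|[a aA]] := set_0Vmem A.
    by exists 1; apply/esym/maxA; rewrite ?A0 ?sub0set.
  by exists a; apply/esym/eqP; rewrite eqEcard sub1set aA cards1 ltT.
apply/maximal_subsemigroupP; split=> // B _ /ltT leB aB.
by apply/esym/eqP; rewrite eqEcard aB cards1.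
Qed.

End DegreeOne.

Theorem theorem4p2 :
  (forall n : nat, (2 <= n)%N ->
    let caseA (U : {set ptn n}) := ~: sym_units n :|: U in
    let caseB := ~: [set a : ptn n | (ptn_rank a == n - 1)%N
                                     && trivial_rel (ptn_ker a)] in
    let caseC := ~: [set a : ptn n | (ptn_rank a == n - 1)%N
                                     && (ptn_dom a == [set: 'I_n])] in
    let caseD := ~: [set a : ptn n | (ptn_rank a == n - 1)%N
                                     && trivial_rel (ptn_coker a)] in
    let caseE := ~: [set a : ptn n | (ptn_rank a == n - 1)%N
                                     && (ptn_codom a == [set: 'I_n])] in
    [/\ forall A : {set ptn n}, maximal_subsemigroup A <->
          (exists2 U : {set ptn n}, maximal_subgroup (sym_units n) U & A = caseA U)
          \/ A = caseB \/ A = caseC \/ A = caseD \/ A = caseE,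
        forall U : {set ptn n}, maximal_subgroup (sym_units n) U -> type_M5 (caseA U),
        type_M4 caseB /\ type_M4 caseC,
        type_M3 caseD /\ type_M3 caseE
      & #|[set A : {set ptn n} | maximal_subsemigroup A]|
        = (#|[set G : {group 'S_n} | maximal G [set: 'S_n]]| + 4)%N])
  /\ [/\ forall a b : ptn 1, a * b = b * a,
         forall a : ptn 1, a * a = a,
         #|{: ptn 1}| = 2
       & forall A : {set ptn 1},
           maximal_subsemigroup A <-> exists a : ptn 1, A = [set a]].
Proof.
split=> [n n_gt1 caseA caseB caseC caseD caseE|]; last first.
  split; [exact: ptn1_mulC | exact: ptn1_idem | exact: card_ptn1 |].
  exact: ptn1_maximal_subsemigroup.
split.
- move=> A; apply: iff_trans (maximal_subsemigroup_cases n_gt1 A) _.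
  split=> [[|[X]]|[|maxA]]; first by left.
  + by rewrite !inE => /or4P[]/eqP-> ->; right;
       [left | right; left | right; right; left | right; right; right].
  + by left.
  right; case: maxA => [->|[->|[->|->]]].
  + by exists (upper_punctured n); rewrite // !inE eqxx.
  + by exists (upper_merged n); rewrite // !inE eqxx ?orbT.
  + by exists (lower_punctured n); rewrite // !inE eqxx ?orbT.
  + by exists (lower_merged n); rewrite // !inE eqxx ?orbT.
- by move=> U; apply: type_M5_nonunitsU.
- by split; apply: (type_M4_upper n_gt1); rewrite !inE eqxx ?orbT.
- by split; apply: (type_M3_lower n_gt1); rewrite !inE eqxx ?orbT.
- exact: card_maximal_subsemigroups.
Qed.
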